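(* Let an $n\times n$ matrix function $G$ admit an $AP$ factorization $G=G_-DG_+^{-1}$ with $D=\mathrm{diag}[e_{\delta_1},\ldots,e_{\delta_n}]$, and let $g_j^\pm$ be the $j$-th column of $G_\pm$. Then the general solution of the problem $G\phi_+=\phi_-$, $\phi_\pm\in(H_\infty^\pm)^n$, is given by $$\phi_+=\sum_j\psi_jg_j^+,\qquad \phi_-=\sum_je_{\delta_j}\psi_jg_j^-,$$ where the summation is with respect to those $j$ for which $\delta_j\le0$, the $\psi_j$ are (arbitrary) constants whenever $\delta_j=0$, and the $\psi_j$ satisfy $$\psi_j\in H_\infty^+\cap e_{-\delta_j}H_\infty^-\quad\text{whenever }\delta_j<0.$$
   Context: $H_\infty^\pm$ is the Hardy class of bounded analytic functions in $\mathbb{C}^\pm=\{z:\pm\mathrm{Im}\, z>0\}$, identified with boundary values on $\mathbb{R}$. $e_\lambda(x)=e^{i\lambda x}$, $\lambda\in\mathbb{R}$. $AP$ is the uniform closure of the set of finite linear combinations of the $e_\lambda$; for $f\in AP$, $M(f)=\lim_{T\to\infty}\frac1{2T}\int_{-T}^Tf(t)\,dt$, $\widehat f(\lambda)=M(e_{-\lambda}f)$, $\Omega(f)=\{\lambda\in\mathbb{R}:\widehat f(\lambda)\ne0\}$. $AP^\pm=\{f\in AP:\Omega(f)\subset\mathbb{R}_\pm\}$, $\mathbb{R}_\pm=\{x:\pm x\ge0\}$. An $AP$ factorization of $G$ is a representation $G=G_-DG_+^{-1}$ with $G_+^{\pm1}\in(AP^+)^{n\times n}$, $G_-^{\pm1}\in(AP^-)^{n\times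 n}$, $D=\mathrm{diag}[e_{\delta_1},\ldots,e_{\delta_n}]$, $\delta_j\in\mathbb{R}$; the $\delta_j$ are the partial $AP$ indices of $G$. *)

(* Defs.v *)
From HB Require Import structures.
From mathcomp Require Import all_boot all_order all_algebra.
From mathcomp Require Import all_classical all_reals all_analysis.
From mathcomp Require Export complex.
Set Implicit Arguments.
Unset Strict Implicit.
Unset Printing Implicit Defensive.
Import Order.TTheory GRing.Theory Num.Theory numFieldNormedType.Exports.
Local Open Scope classical_set_scope.
Local Open Scope complex_scope.
Local Open Scope ring_scope.

Section Defs.
Variable R : realType.
Notation C := R[i].
Notation mu := (@lebesgue_measure R).

Definition upper_half : set C := [set z | 0 < complex.Im z].
Definition lower_half : set C := [set z | complex.Im z < 0].

(* complex differentiability: the scalar field of C^o is C itself *)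
Definition analytic_on (U : set C) (F : C -> C) : Prop :=
  forall z, U z -> derivable (F : C^o -> C^o) z 1.

Definition bounded_fun_on (U : set C) (F : C -> C) : Prop :=
  exists M : R, forall z, U z -> `|F z| <= M%:C.

(* approach region at the real point x; a bounds the aperture *)
Definition stolz (a x : R) : set C :=
  [set z | `|complex.Re z - x| <= a * `|complex.Im z| ].

Definition nontangential_limit (U : set C) (F : C -> C) (x : R) (w : C) :=
  forall a : R, 0 < a ->
    (F : C^o -> C^o) @ within (U `&` stolz a x) (nbhs (x%:C : C^o))
      --> (w : C^o).

(* The members of the Hardy classes are represented by their boundary values,
   functions on the line that matter only up to Lebesgue null sets. *)
Definition Hinf (U : set C) : set (R -> C) :=
  [set f | exists F : C -> C,
    [/\ analytic_on U F, bounded_fun_on U F &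
        {ae mu, forall x, nontangential_limit U F x (f x)}]].

Definition Hinf_plus : set (R -> C) := Hinf upper_half.
Definition Hinf_minus : set (R -> C) := Hinf lower_half.

(* exp(i lambda x), by Euler's formula *)
Definition e_ (lambda : R) (x : R) : C :=
  cos (lambda * x) +i* sin (lambda * x).

Definition trig_poly (s : seq (C * R)) (x : R) : C :=
  \sum_(p <- s) p.1 * e_ p.2 x.

Definition AP : set (R -> C) :=
  [set f | forall eps : R, 0 < eps ->
    exists s : seq (C * R), forall x : R, `|f x - trig_poly s x| <= eps%:C].

Definition cintegral (A : set R) (f : R -> C) : C :=
  (\int[mu]_(x in A) complex.Re (f x)) +i*
  (\int[mu]_(x in A) complex.Im (f x)).

Definition mean_value (f : R -> C) : C :=
  lim (((2 * T)^-1%:C * cintegral `[- T, T] f : C^o) @[T --> +oo]).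

Definition fourier_coef (f : R -> C) (lambda : R) : C :=
  mean_value (fun x => e_ (- lambda) x * f x).

Definition Omega (f : R -> C) : set R :=
  [set lambda | fourier_coef f lambda != 0].

Definition AP_plus : set (R -> C) :=
  [set f | AP f /\ Omega f `<=` [set x | 0 <= x]].
Definition AP_minus : set (R -> C) :=
  [set f | AP f /\ Omega f `<=` [set x | x <= 0]].

(* unitmx is required because invmx returns its argument on singular matrices *)
Definition invertible_over (n : nat) (S : set (R -> C)) (A : R -> 'M[C]_n) :=
  [/\ forall x, A x \in unitmx,
      forall i j, S (fun x => A x i j) &
      forall i j, S (fun x => invmx (A x) i j)].

Definition AP_factorization (n : nat) (G Gm Gp : R -> 'M[C]_n)
    (delta : 'I_n -> R) : Prop :=
  [/\ invertible_over AP_plus Gp,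
      invertible_over AP_minus Gm &
      forall x, G x =
        Gm x *m diag_mx (\row_j e_ (delta j) x) *m invmx (Gp x)].

(* the class e_lambda S, again up to null sets *)
Definition e_shift (lambda : R) (S : set (R -> C)) : set (R -> C) :=
  [set f | exists2 h, S h & {ae mu, forall x, f x = e_ lambda x * h x}].

Definition is_solution (n : nat) (G : R -> 'M[C]_n)
    (phip phim : R -> 'cV[C]_n) : Prop :=
  [/\ forall i, Hinf_plus (fun x => phip x i 0),
      forall i, Hinf_minus (fun x => phim x i 0) &
      {ae mu, forall x, G x *m phip x = phim x}].

Definition admissible_coef (delta : R) (psi : R -> C) : Prop :=
  (delta = 0 -> exists c : C, {ae mu, forall x, psi x = c}) /\
  (delta < 0 -> (Hinf_plus `&` e_shift (- delta) Hinf_minus) psi).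

End Defs.

(* Main.v *)
Require Import Defs.
From HB Require Import structures.
From mathcomp Require Import all_boot all_order all_algebra.
From mathcomp Require Import all_classical all_reals all_analysis.
From mathcomp Require Import measurable_realfun.
From mathcomp Require Import ring lra.
Set Implicit Arguments.
Unset Strict Implicit.
Unset Printing Implicit Defensive.
Import Order.TTheory GRing.Theory Num.Theory numFieldNormedType.Exports.
Local Open Scope classical_set_scope.
Local Open Scope complex_scope.
Local Open Scope ring_scope.

(** The factorization turns [G phi_+ = phi_-] into the diagonal problem
    [e_(delta_j) psi_j = chi_j], where [psi = G_+^-1 phi_+] has its entries in
    the upper Hardy class and [chi = G_-^-1 phi_-] has its entries in the lower
    one.  Two facts settle this problem: (a) the Hardy classes are algebras
    that contain the classes AP of the same sign, and (b) a function that is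
    in both Hardy classes is constant.  If [delta_j = 0], then (b) makes
    [psi_j] constant.  If [delta_j > 0] and F extends [psi_j], then
    [F(z) exp(i delta_j z)] has boundary values [chi_j], hence is a constant c
    by (b), and [F(z) = c exp(- i delta_j z)] is bounded on the imaginary axis
    only for [c = 0].  If [delta_j < 0], the equation is the condition in the
    theorem.  The rest is matrix algebra.

    For (b), [poisson_formula] writes a bounded analytic F as the Poisson
    integral of its values on any lower horizontal line; it comes from
    Goursat's theorem on large rectangles, applied to the quotient
    [(F(w) - F(z)) / ((w - z) (w - conj z))].  If F and G, in the upper and in
    the lower half-plane, have the same boundary values almost everywhere,
    then moving the line to the boundary from both sides gives
    [F(z) = G(conj z)].  So F is analytic and antianalytic at once, [F' = 0],
    and F is constant: [hardy_liouville].

    For (a), [AP_approx_spectrum] shows that an almost periodic f is a uniform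
    limit of trigonometric polynomials with frequencies in the spectrum of f.
    This is Bochner-Fejer summation; the kernel is built here from a Folner
    set in the additive group generated by finitely many frequencies, which
    avoids the choice of a basis over the rationals.  Polynomials with
    nonnegative frequencies extend to bounded analytic functions in the upper
    half-plane, where the Poisson formula bounds the extensions and their
    difference quotients by the supremum on the line.  Hence the extensions
    converge to a bounded analytic function that is continuous up to the line:
    [nonneg_approx_Hinf_plus]. *)

(** * Integrals over segments *)

Section Segments.
Variable R : realType.
Notation mu := (@lebesgue_measure R).
Implicit Types (f g : R -> R) (a b : R).

Definition cont_on f a b := forall x, a <= x <= b -> {for x, continuous f}.

Lemma cont_on_integrable f a b : cont_on f a b ->
  mu.-integrable `[a, b] (EFin \o f).
Proof.
move=> cf; apply: continuous_compact_integrable; first exact: segment_compact.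
by apply: continuous_in_subspaceT => x; rewrite inE/= in_itv/=; exact: cf.
Qed.

Lemma Rintegral_split f a m b : cont_on f a b -> a <= m <= b ->
  \int[mu]_(x in `[a, b]) f x =
  \int[mu]_(x in `[a, m]) f x + \int[mu]_(x in `[m, b]) f x.
Proof.
move=> cf /andP[am mb].
have fi := cont_on_integrable cf.
have := @Rintegral_itvB R f (BLeft a) (BRight b) m fi.
rewrite !bnd_simp => /(_ am mb) H.
rewrite -[X in _ + X]Rintegral_itv_obnd_cbnd; last first.
  by apply: integrableS fi => //; apply: subset_itvr; rewrite bnd_simp.
by rewrite -H addrC subrK.
Qed.

Lemma Rintegral_seg_cst a b (k : R) : a <= b ->
  \int[mu]_(x in `[a, b]) k = k * (b - a).
Proof.
move=> ab; rewrite Rintegral_cst//= lebesgue_measure_itv/= lte_fin.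
case: ltP => [_|]; first by rewrite -EFinD.
move=> ba; have -> : a = b by apply: le_anti; rewrite ab ba.
by rewrite subrr.
Qed.

Lemma Rintegral_seg_le f a b (k : R) : a <= b -> cont_on f a b ->
  (forall x, a <= x <= b -> `|f x| <= k) ->
  `|\int[mu]_(x in `[a, b]) f x| <= k * (b - a).
Proof.
move=> ab cf fk.
have fi := cont_on_integrable cf.
apply: le_trans (le_normr_Rintegral _ fi) _ => //.
rewrite -Rintegral_seg_cst//; apply: le_Rintegral => //.
- exact: integrable_norm fi.
- by apply: cont_on_integrable => x _; exact: cst_continuous.
Qed.

Lemma cont_onB f g a b : cont_on f a b -> cont_on g a b ->
  cont_on (fun x => f x - g x) a b.
Proof. by move=> cf cg x xab; apply: cvgB; [exact: cf|exact: cg]. Qed.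

Lemma cont_on_cst a b (k : R) : cont_on (fun=> k) a b.
Proof. by move=> x _; exact: cst_continuous. Qed.

Lemma cont_on_sub f a b a' b' : a <= a' -> b' <= b ->
  cont_on f a b -> cont_on f a' b'.
Proof.
move=> aa bb cf x /andP[ax xb]; apply: cf.
by rewrite (le_trans aa ax) (le_trans xb bb).
Qed.

Lemma Rintegral_seg_B f g a b : cont_on f a b -> cont_on g a b ->
  \int[mu]_(x in `[a, b]) (f x - g x) =
  \int[mu]_(x in `[a, b]) f x - \int[mu]_(x in `[a, b]) g x.
Proof. by move=> cf cg; rewrite RintegralB//; exact: cont_on_integrable. Qed.

End Segments.

(** * Goursat theorem for real one-forms *)

Section Goursat.
Variable R : realType.
Notation mu := (@lebesgue_measure R).
Variables p q : R -> R -> R.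

(** [p dx + q dy] is differentiable at the point, with [dp/dy = dq/dx] there.  The
    derivatives are taken at the point alone, because complex differentiability
    at each point does not by itself make the derivative continuous. *)
Definition closed_at (x y : R) := exists a b c : R,
  forall eps, 0 < eps -> exists2 dl, 0 < dl &
  forall h k, `|h| < dl -> `|k| < dl ->
    `|p (x + h) (y + k) - p x y - (a * h + b * k)| <= eps * (`|h| + `|k|) /\
    `|q (x + h) (y + k) - q x y - (b * h + c * k)| <= eps * (`|h| + `|k|).

Definition closed_on a b c d :=
  forall x y, a <= x <= b -> c <= y <= d -> closed_at x y.

(** The slices of [p] and [q] along which the contour integrals below are taken. *)
Definition cont_rect (a b c d : R) :=
  (forall y, c <= y <= d -> cont_on (p ^~ y) a b) /\
  (forall x, a <= x <= b -> cont_on (q x) c d).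

Lemma closed_at_cont x y : closed_at x y ->
  {for x, continuous (p ^~ y)} /\ {for y, continuous (q x)}.
Proof.
have lin (u v w e h : R) : `|w - v - u * h| <= e * `|h| -> `|v - w| <= (`|u| + e) * `|h|.
  move=> H; rewrite distrC.
  have -> : w - v = (w - v - u * h) + u * h by ring.
  by rewrite (le_trans (ler_normD _ _))// normrM mulrDl addrC lerD2l.
have fin (f : R -> R) (s u : R) : (exists2 dl, 0 < dl & forall h, `|h| < dl -> `|f (s + h) - f s - u * h| <= 1 * `|h|) ->
  {for s, continuous f}.
  move=> [dl dl0 H]; apply/cvgrPdist_le => e e0.
  near=> t.
  have -> : t = s + (t - s) by rewrite addrC subrK.
  apply: le_trans (lin _ _ _ _ _ (H _ _)) _.
    near: t; apply: (cvgr_distC_lt _ _ _ _); [exact: cvg_id|exact: dl0].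
  rewrite -ler_pdivlMl ?ltr_wpDl//.
  near: t; apply: (cvgr_distC_le _ _ _ _); first exact: cvg_id.
  by rewrite mulr_gt0// invr_gt0 ltr_wpDl.
move=> [u [v [w /(_ 1 ltr01)[dl dl0 K]]]]; split.
- apply: (fin _ _ u); exists dl => // h hd.
  have [+ _] := K h 0 hd ltac:(by rewrite normr0).
  by rewrite !addr0 mulr0 addr0 normr0 addr0.
- apply: (fin _ _ w); exists dl => // h hd.
  have [_ +] := K 0 h ltac:(by rewrite normr0) hd.
  by rewrite !addr0 mulr0 add0r normr0 add0r.
Unshelve. all: by end_near. Qed.

Lemma closed_on_cont a b c d : closed_on a b c d -> cont_rect a b c d.
Proof.
by move=> H; split=> [y yc x xa|x xa y yc]; case: (closed_at_cont (H x y xa yc)).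
Qed.

(** Counterclockwise integral of [p dx + q dy] over the sides of a rectangle.
    Opposite sides share an integrand, so that the terms in which [p] and [q]
    are constant cancel before integration. *)
Definition oint a b c d :=
  \int[mu]_(x in `[a, b]) (p x c - p x d) +
  \int[mu]_(y in `[c, d]) (q b y - q a y).

Lemma oint_splitx a m b c d : a <= m <= b -> c <= d ->
  cont_on (p ^~ c) a b -> cont_on (p ^~ d) a b ->
  cont_on (q a) c d -> cont_on (q m) c d -> cont_on (q b) c d ->
  oint a b c d = oint a m c d + oint m b c d.
Proof.
move=> amb cd pc pd qa qm qb; rewrite /oint.
rewrite (@Rintegral_split _ (fun x => p x c - p x d) a m b)//; last exact: cont_onB.
have E : \int[mu]_(y in `[c, d]) (q b y - q a y) =
    \int[mu]_(y in `[c, d]) (q m y - q a y) + \int[mu]_(y in `[c, d]) (q b y - q m y).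
  by rewrite !Rintegral_seg_B//; ring.
rewrite E; ring.
Qed.

Lemma oint_splity a b c m d : a <= b -> c <= m <= d ->
  cont_on (p ^~ c) a b -> cont_on (p ^~ m) a b -> cont_on (p ^~ d) a b ->
  cont_on (q a) c d -> cont_on (q b) c d ->
  oint a b c d = oint a b c m + oint a b m d.
Proof.
move=> ab cmd pc pm pd qa qb; rewrite /oint.
rewrite (@Rintegral_split _ (fun y => q b y - q a y) c m d)//; last exact: cont_onB.
have E : \int[mu]_(x in `[a, b]) (p x c - p x d) =
    \int[mu]_(x in `[a, b]) (p x c - p x m) + \int[mu]_(x in `[a, b]) (p x m - p x d).
  by rewrite !Rintegral_seg_B//; ring.
rewrite E; ring.
Qed.

Lemma cont_rectS a b c d a' b' c' d' : a <= a' -> b' <= b -> c <= c' -> d' <= d ->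
  cont_rect a b c d -> cont_rect a' b' c' d'.
Proof.
move=> aa bb cc dd [cp cq]; split.
  move=> y /andP[cy yd]; apply: (cont_on_sub aa bb); apply: cp.
  by rewrite (le_trans cc cy) (le_trans yd dd).
move=> x /andP[ax xb]; apply: (cont_on_sub cc dd); apply: cq.
by rewrite (le_trans aa ax) (le_trans xb bb).
Qed.

Lemma oint_le a b c d (k : R) : a <= b -> c <= d ->
  cont_on (p ^~ c) a b -> cont_on (p ^~ d) a b ->
  cont_on (q a) c d -> cont_on (q b) c d ->
  (forall x, a <= x <= b -> `|p x c| <= k /\ `|p x d| <= k) ->
  (forall y, c <= y <= d -> `|q a y| <= k /\ `|q b y| <= k) ->
  `|oint a b c d| <= 2 * k * ((b - a) + (d - c)).
Proof.
move=> ab cd pc pd qa qb Hp Hq; rewrite /oint (le_trans (ler_normD _ _))// mulrDr.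
apply: lerD; apply: Rintegral_seg_le => //; try exact: cont_onB.
- move=> x /Hp[h1 h2]; rewrite (le_trans (ler_normB _ _))//; lra.
- move=> y /Hq[h1 h2]; rewrite (le_trans (ler_normB _ _))//; lra.
Qed.

Section Bisection.
Variables a b c d : R.
Hypotheses (ab : a <= b) (cd : c <= d) (cl : closed_on a b c d).

Let w n := (b - a) / 2 ^+ n.
Let v n := (d - c) / 2 ^+ n.
Let I n (s : R * R) := oint s.1 (s.1 + w n) s.2 (s.2 + v n).
Let inside n (s : R * R) :=
  [/\ a <= s.1, s.1 + w n <= b, c <= s.2 & s.2 + v n <= d].

Let wS n : w n = w n.+1 + w n.+1.
Proof. by rewrite /w exprS invfM -mulrDl; field; rewrite expf_neq0. Qed.
Let vS n : v n = v n.+1 + v n.+1.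
Proof. by rewrite /v exprS invfM -mulrDl; field; rewrite expf_neq0. Qed.
Let w_ge0 n : 0 <= w n.
Proof. by rewrite /w divr_ge0 ?subr_ge0// exprn_ge0. Qed.
Let v_ge0 n : 0 <= v n.
Proof. by rewrite /v divr_ge0 ?subr_ge0// exprn_ge0. Qed.

(* The first quarter that keeps at least a quarter of the integral; the last one
   is taken by default. *)
Let next n (s : R * R) : R * R :=
  let small t := `|I n s| <= 4 * `|I n.+1 t| in
  if small s then s else
  if small (s.1 + w n.+1, s.2) then (s.1 + w n.+1, s.2) else
  if small (s.1, s.2 + v n.+1) then (s.1, s.2 + v n.+1) else
  (s.1 + w n.+1, s.2 + v n.+1).

Let next_spec n s : inside n s ->
  [/\ s.1 <= (next n s).1, s.2 <= (next n s).2,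
    (next n s).1 + w n.+1 <= s.1 + w n, (next n s).2 + v n.+1 <= s.2 + v n
    & inside n.+1 (next n s) /\ `|I n s| <= 4 * `|I n.+1 (next n s)|].
Proof.
case: s => x y [/= h1 h2 h3 h4].
have w0 := w_ge0 n.+1; have v0 := v_ge0 n.+1.
have hw := wS n; have hv := vS n.
rewrite /next /=; case: ifPn => [H|H1].
  by split=> //=; [..|split=> //; split=> /=]; lra.
case: ifPn => [H|H2].
  by split=> //=; [..|split=> //; split=> /=]; lra.
case: ifPn => [H|H3].
  by split=> //=; [..|split=> //; split=> /=]; lra.
split=> //=; [lra|lra|lra|lra|split; first by split=> /=; lra].
have : `|I n (x, y)| <= `|I n.+1 (x, y)| + `|I n.+1 (x + w n.+1, y)| +
    `|I n.+1 (x, y + v n.+1)| + `|I n.+1 (x + w n.+1, y + v n.+1)|.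
  rewrite /I /=.
  have cr : cont_rect x (x + w n) y (y + v n).
    by apply: (cont_rectS _ _ _ _ (closed_on_cont cl)).
  have xm : x <= x + w n.+1 <= x + w n by rewrite hw; lra.
  have ym : y <= y + v n.+1 <= y + v n by rewrite hv; lra.
  have [xx xw] : x <= x <= x + w n /\ x <= x + w n <= x + w n by rewrite hw; lra.
  have [yy yv] : y <= y <= y + v n /\ y <= y + v n <= y + v n by rewrite hv; lra.
  have [/andP[xm1 xm2] /andP[ym1 ym2]] := (xm, ym).
  have [/andP[_ xw1] /andP[_ yv1]] := (xx, yy).
  case: cr => cp cq.
  rewrite (@oint_splitx _ (x + w n.+1))//; try exact: cp; try exact: cq.
  rewrite (@oint_splity x (x + w n.+1) y (y + v n.+1))//;
    try (by apply: cont_on_sub (cp _ _)); try exact: cq.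
  rewrite (@oint_splity (x + w n.+1) (x + w n) y (y + v n.+1))//;
    try (by apply: cont_on_sub (cp _ _)); try exact: cq.
  clear xm ym xx xw yy yv cp cq.
  have e1 : x + w n.+1 + w n.+1 = x + w n by rewrite hw; ring.
  have e2 : y + v n.+1 + v n.+1 = y + v n by rewrite hv; ring.
  rewrite !e1 !e2.
  move: (oint _ _ _ _) (oint _ _ _ _) (oint _ _ _ _) (oint _ _ _ _) => A C B D.
  have := ler_normD (D + B) (C + A); have := ler_normD D B; have := ler_normD C A.
  clear H1 H2 H3; lra.
move: H1 H2 H3; rewrite -!ltNge; lra.
Qed.

Let seqs := fix seqs n := if n is m.+1 then next m (seqs m) else (a, c).

Let seqs_inside n : inside n (seqs n).
Proof.
elim: n => [|n IH]; last by case: (next_spec IH) => _ _ _ _ [].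
by split=> /=; rewrite /w /v ?expr0 ?divr1; lra.
Qed.

Let seqs_I n : `|oint a b c d| <= 4 ^+ n * `|I n (seqs n)|.
Proof.
elim: n => [|n IH].
  by rewrite expr0 mul1r /I /= /w /v expr0 !divr1 !(addrC _ (_ - _)) !subrK.
apply: le_trans IH _; rewrite exprSr -mulrA ler_wpM2l ?exprn_ge0//.
by case: (next_spec (seqs_inside n)) => _ _ _ _ [].
Qed.

Let seqs_mono m n : (m <= n)%N ->
  [/\ (seqs m).1 <= (seqs n).1, (seqs m).2 <= (seqs n).2,
    (seqs n).1 + w n <= (seqs m).1 + w m &
    (seqs n).2 + v n <= (seqs m).2 + v m].
Proof.
elim: n => [|n IH]; first by rewrite leqn0 => /eqP ->.
rewrite leq_eqVlt => /predU1P[->//|/IH [h1 h2 h3 h4]].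
have [k1 k2 k3 k4 _] := next_spec (seqs_inside n).
by split; [apply: le_trans k1|apply: le_trans k2|apply: le_trans h3|apply: le_trans h4].
Qed.

Let limit_point : exists x y, forall n,
  (seqs n).1 <= x <= (seqs n).1 + w n /\ (seqs n).2 <= y <= (seqs n).2 + v n.
Proof.
exists (sup (range (fun n => (seqs n).1))), (sup (range (fun n => (seqs n).2))).
have ub1 m n : (seqs m).1 <= (seqs n).1 + w n.
  have [mn|/ltnW nm] := leqP m n.
    by have [h _ _ _] := seqs_mono mn; rewrite (le_trans h)// lerDl.
  by have [_ _ h _] := seqs_mono nm; rewrite (le_trans _ h)// lerDl.
have ub2 m n : (seqs m).2 <= (seqs n).2 + v n.
  have [mn|/ltnW nm] := leqP m n.
    by have [_ h _ _] := seqs_mono mn; rewrite (le_trans h)// lerDl.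
  by have [_ _ _ h] := seqs_mono nm; rewrite (le_trans _ h)// lerDl.
move=> n; split; apply/andP; split.
- apply: ub_le_sup; last by exists n.
  by exists ((seqs 0).1 + w 0) => _ [m _ <-].
- by apply: ge_sup; [exists (seqs 0).1, 0%N|move=> _ [m _ <-]].
- apply: ub_le_sup; last by exists n.
  by exists ((seqs 0).2 + v 0) => _ [m _ <-].
- by apply: ge_sup; [exists (seqs 0).2, 0%N|move=> _ [m _ <-]].
Qed.

(** Repeated bisection gives nested rectangles that keep at least the fraction
    [4^-n] of the integral.  They shrink to a point where the form is, up to an
    error of the order of [eps] times the diameter, a closed linear form, which
    has integral 0.  Since the perimeter also shrinks like [2^-n], the integral
    is at most [eps] times a constant. *)
Theorem goursat : oint a b c d = 0.
Proof.
have [x [y xy]] := limit_point.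
have [/andP[/= h1 h2] /andP[/= h3 h4]] := xy 0%N.
have [al [be [ga H]]] : closed_at x y.
  by case: (seqs_inside 0%N) => k1 k2 k3 k4; apply: cl; apply/andP; split;
    apply: le_trans; eassumption.
set S := (b - a) + (d - c).
have S0 : 0 <= S by rewrite addr_ge0// subr_ge0.
suff K eps : 0 < eps -> `|oint a b c d| <= eps * (2 * S * S).
  apply/eqP; rewrite -normr_le0; apply/ler_addgt0Pr => e e0.
  rewrite add0r; apply: (le_trans (K (e / (2 * S * S + 1)) _)).
    by rewrite divr_gt0// ltr_wpDl// !mulr_ge0.
  rewrite mulrAC ler_pdivrMr ?ltr_wpDl ?mulr_ge0//.
  by rewrite ler_pM2l// lerDl.
move=> e0; have [dl dl0 {}H] := H _ e0.
have [n Hn] : exists n, S / 2 ^+ n < dl.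
  exists (Num.trunc (S / dl)); rewrite ltr_pdivrMr ?exprn_gt0//.
  rewrite -ltr_pdivrMl// mulrC (lt_le_trans (truncnS_gt _))//.
  by rewrite -natrX ler_nat ltn_expl.
have ewv : w n + v n = S / 2 ^+ n by rewrite /w /v -mulrDl.
have wv : w n + v n < dl by rewrite ewv.
apply: le_trans (seqs_I n) _.
case: (xy n) (seqs_inside n).
move: (seqs n) => -[x0 y0] /= /andP[x1 x2] /andP[y1 y2] [/= i1 i2 i3 i4].
have w0 := w_ge0 n; have v0 := v_ge0 n.
have near_pq s t : x0 <= s <= x0 + w n -> y0 <= t <= y0 + v n ->
  `|p s t - p x y - (al * (s - x) + be * (t - y))| <= eps * (w n + v n) /\
  `|q s t - q x y - (be * (s - x) + ga * (t - y))| <= eps * (w n + v n).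
  move=> /andP[s1 s2] /andP[t1 t2].
  have a1 : `|s - x| <= w n by rewrite ler_norml; lra.
  have a2 : `|t - y| <= v n by rewrite ler_norml; lra.
  have a3 : `|s - x| < dl by rewrite (le_lt_trans a1)// (le_lt_trans _ wv)// lerDl.
  have a4 : `|t - y| < dl by rewrite (le_lt_trans a2)// (le_lt_trans _ wv)// lerDr.
  have := H (s - x) (t - y) a3 a4.
  have -> : x + (s - x) = s by ring.
  have -> : y + (t - y) = t by ring.
  have le : eps * (`|s - x| + `|t - y|) <= eps * (w n + v n) by rewrite ler_pM2l// lerD.
  by move=> [k1 k2]; split; [apply: le_trans k1 _|apply: le_trans k2 _].
have [cp cq] : cont_rect x0 (x0 + w n) y0 (y0 + v n).
  by apply: (cont_rectS _ _ _ _ (closed_on_cont cl)).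
have xx : x0 <= x0 <= x0 + w n by lra.
have xw : x0 <= x0 + w n <= x0 + w n by lra.
have yy : y0 <= y0 <= y0 + v n by lra.
have yv : y0 <= y0 + v n <= y0 + v n by lra.
have i1' := cont_onB (cp _ yy) (cp _ yv).
have i2' := cont_onB (cq _ xw) (cq _ xx).
(* The linear part of the form contributes [- be * v n] and [be * w n] to the two
   integrands; these terms have opposite integrals. *)
have E : I n (x0, y0) =
  \int[mu]_(s in `[x0, x0 + w n]) (p s y0 - p s (y0 + v n) - - (be * v n)) +
  \int[mu]_(t in `[y0, y0 + v n]) (q (x0 + w n) t - q x0 t - be * w n).
  rewrite [X in _ = X + _]Rintegral_seg_B//; last exact: cont_on_cst.
  rewrite [X in _ = _ + X]Rintegral_seg_B//; last exact: cont_on_cst.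
  rewrite !Rintegral_seg_cst ?lerDl// /I /oint /=; ring.
have B1 : `|\int[mu]_(s in `[x0, x0 + w n]) (p s y0 - p s (y0 + v n) - - (be * v n))| <=
   2 * eps * (w n + v n) * w n.
  rewrite [X in _ <= _ * X](_ : _ = x0 + w n - x0); last by ring.
  apply: Rintegral_seg_le; rewrite ?lerDl//.
    by apply: cont_onB i1' _; exact: cont_on_cst.
  move=> s hs; have [k1 _] := near_pq _ _ hs yy; have [k2 _] := near_pq _ _ hs yv.
  move: k1 k2; rewrite !ler_norml; lra.
have B2 : `|\int[mu]_(t in `[y0, y0 + v n]) (q (x0 + w n) t - q x0 t - be * w n)| <=
   2 * eps * (w n + v n) * v n.
  rewrite [X in _ <= _ * X](_ : _ = y0 + v n - y0); last by ring.
  apply: Rintegral_seg_le; rewrite ?lerDl//.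
    by apply: cont_onB i2' _; exact: cont_on_cst.
  move=> t ht; have [_ k1] := near_pq _ _ xw ht; have [_ k2] := near_pq _ _ xx ht.
  move: k1 k2; rewrite !ler_norml; lra.
have : `|I n (x0, y0)| <= 2 * eps * (w n + v n) * (w n + v n).
  by rewrite E (le_trans (ler_normD _ _))// mulrDr lerD.
rewrite ewv => HI.
rewrite (le_trans (ler_wpM2l _ HI)) ?exprn_ge0//.
rewrite le_eqVlt; apply/orP; left; apply/eqP.
have -> : 4 ^+ n = 2 ^+ n * 2 ^+ n :> R by rewrite -exprMn; congr (_ ^+ _); ring.
by field; rewrite expf_neq0.
Qed.

End Bisection.

(** Lines at distance e from the exceptional point cut the rectangle into four
    rectangles without that point, where the integral is 0, and a square on
    which it is at most [8 k e]. *)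
Theorem goursat_puncture a b c d x0 y0 r k :
  a < x0 < b -> c < y0 < d -> 0 < r ->
  (forall x y, a <= x <= b -> c <= y <= d -> (x, y) != (x0, y0) ->
     closed_at x y) ->
  (forall x y, `|x - x0| <= r -> `|y - y0| <= r -> (x, y) != (x0, y0) ->
     `|p x y| <= k /\ `|q x y| <= k) ->
  oint a b c d = 0.
Proof.
move=> /andP[ax xb] /andP[cy yd] r0 cl bd.
have cp y : c <= y <= d -> y != y0 -> cont_on (p ^~ y) a b.
  by move=> hy ny x hx; have [] := closed_at_cont (cl x y hx hy
    ltac:(by rewrite xpair_eqE (negbTE ny) andbF)).
have cq x : a <= x <= b -> x != x0 -> cont_on (q x) c d.
  by move=> hx nx y hy; have [] := closed_at_cont (cl x y hx hy
    ltac:(by rewrite xpair_eqE (negbTE nx))).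
have k0 : 0 <= k.
  have [|||+ _] := bd (x0 + r) y0.
  - by rewrite addrC addKr gtr0_norm.
  - by rewrite subrr normr0 ltW.
  - by rewrite xpair_eqE gt_eqF// ltrDl.
  exact: le_trans.
suff K e : 0 < e -> e < x0 - a -> e < b - x0 -> e < y0 - c -> e < d - y0 -> e <= r ->
    `|oint a b c d| <= 8 * k * e.
  apply/eqP; rewrite -normr_le0; apply/ler_addgt0Pr => e e0.
  rewrite add0r.
  pose m := Num.min r (Num.min (Num.min (x0 - a) (b - x0)) (Num.min (y0 - c) (d - y0))).
  have m0 : 0 < m by rewrite !lt_min; lra.
  have : m <= m by [].
  rewrite {2}/m !le_min => /andP[m1 /andP[/andP[m2 m3] /andP[m4 m5]]].
  pose t := Num.min (m / 2) (e / (8 * k + 1)).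
  have : t <= t by [].
  rewrite {2}/t le_min => /andP[t1 t2].
  have t0 : 0 < t by rewrite lt_min !divr_gt0// ltr_wpDl// mulr_ge0.
  apply: le_trans (K t t0 _ _ _ _ _) _; try lra.
  have : (8 * k + 1) * t <= e.
    by rewrite mulrC -ler_pdivlMr// ltr_wpDl// mulr_ge0.
  lra.
move=> e0 e1 e2 e3 e4 er.
have [A1 A2 A3 A4] : [/\ a <= x0 - e, x0 - e <= x0 + e, x0 + e <= b & a <= x0 + e].
  by split; lra.
have [C1 C2 C3 C4] : [/\ c <= y0 - e, y0 - e <= y0 + e, y0 + e <= d & c <= y0 + e].
  by split; lra.
have [D1 D2] : c <= d /\ a <= b by split; lra.
have [N1 N2] : x0 - e != x0 /\ x0 + e != x0.
  by split; [rewrite lt_eqF// ltrBlDr ltrDl|rewrite gt_eqF// ltrDl].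
have [N3 N4] : y0 - e != y0 /\ y0 + e != y0.
  by split; [rewrite lt_eqF// ltrBlDr ltrDl|rewrite gt_eqF// ltrDl].
have [N5 N6] : a != x0 /\ b != x0 by rewrite lt_eqF// gt_eqF.
have [N7 N8] : c != y0 /\ d != y0 by rewrite lt_eqF// gt_eqF.
have pa : cont_on (p ^~ c) a b by apply: cp => //; rewrite lexx.
have pb : cont_on (p ^~ d) a b by apply: cp => //; rewrite lexx D1.
have pm1 : cont_on (p ^~ (y0 - e)) a b by apply: cp => //; rewrite C1 (le_trans C2).
have pm2 : cont_on (p ^~ (y0 + e)) a b by apply: cp => //; rewrite C4.
have qa : cont_on (q a) c d by apply: cq => //; rewrite lexx.
have qb : cont_on (q b) c d by apply: cq => //; rewrite lexx D2.
have qm1 : cont_on (q (x0 - e)) c d by apply: cq => //; rewrite A1 (le_trans A2).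
have qm2 : cont_on (q (x0 + e)) c d by apply: cq => //; rewrite A4.
have cls a' b' c' d' : a <= a' -> b' <= b -> c <= c' -> d' <= d ->
   (forall x y, a' <= x <= b' -> c' <= y <= d' -> (x, y) != (x0, y0)) ->
   closed_on a' b' c' d'.
  move=> h1 h2 h3 h4 ne x y /[dup] hx /andP[x1 x2] /[dup] hy /andP[y1 y2].
  by apply: cl; [rewrite (le_trans h1 x1) (le_trans x2)|rewrite (le_trans h3 y1) (le_trans y2)|apply: ne].
have nx x y : x != x0 -> (x, y) != (x0, y0) by rewrite xpair_eqE => /negbTE ->.
have ny x y : y != y0 -> (x, y) != (x0, y0) by rewrite xpair_eqE andbC => /negbTE ->.
(* Two vertical cuts, then two horizontal cuts of the middle strip. *)
rewrite (@oint_splitx a (x0 - e) b)//; [|by rewrite A1 (le_trans A2)].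
rewrite (@oint_splitx (x0 - e) (x0 + e) b)//; [|by rewrite A2|exact: cont_on_sub pa|exact: cont_on_sub pb].
rewrite (@oint_splity (x0 - e) (x0 + e) c (y0 - e) d)//;
  [|by rewrite C1 (le_trans C2)|exact: cont_on_sub pa|exact: cont_on_sub pm1|exact: cont_on_sub pb].
rewrite (@oint_splity (x0 - e) (x0 + e) (y0 - e) (y0 + e) d)//;
  [|by rewrite C2|exact: cont_on_sub pm1|exact: cont_on_sub pm2|exact: cont_on_sub pb|exact: cont_on_sub qm1|exact: cont_on_sub qm2].
rewrite (@goursat a (x0 - e) c d)//; last first.
  apply: cls; rewrite ?(le_trans A2)// => x y /andP[_ hx] _; apply: nx.
  by rewrite lt_eqF// (le_lt_trans hx)// ltrBlDr ltrDl.
rewrite (@goursat (x0 + e) b c d)//; last first.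
  apply: cls => // x y /andP[hx _] _; apply: nx.
  by rewrite gt_eqF// (lt_le_trans _ hx)// ltrDl.
rewrite (@goursat (x0 - e) (x0 + e) c (y0 - e))//; last first.
  apply: cls; rewrite ?(le_trans C2)// => x y _ /andP[_ hx]; apply: ny.
  by rewrite lt_eqF// (le_lt_trans hx)// ltrBlDr ltrDl.
rewrite (@goursat (x0 - e) (x0 + e) (y0 + e) d)//; last first.
  apply: cls => // x y _ /andP[hx _]; apply: ny.
  by rewrite gt_eqF// (lt_le_trans _ hx)// ltrDl.
rewrite !add0r !addr0.
have -> : 8 * k * e = 2 * k * ((x0 + e - (x0 - e)) + (y0 + e - (y0 - e))) by ring.
apply: oint_le => //; [exact: cont_on_sub pm1|exact: cont_on_sub pm2|exact: cont_on_sub qm1|exact: cont_on_sub qm2|..].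
- move=> x hx; have hx' : `|x - x0| <= r by rewrite ler_norml; lra.
  have [h1 _] := bd x (y0 - e) hx' ltac:(by rewrite ler_norml; lra) ltac:(by apply: ny).
  by have [h2 _] := bd x (y0 + e) hx' ltac:(by rewrite ler_norml; lra) ltac:(by apply: ny).
- move=> y hy; have hy' : `|y - y0| <= r by rewrite ler_norml; lra.
  have [_ h1] := bd (x0 - e) y ltac:(by rewrite ler_norml; lra) hy' ltac:(by apply: nx).
  by have [_ h2] := bd (x0 + e) y ltac:(by rewrite ler_norml; lra) hy' ltac:(by apply: nx).
Qed.

End Goursat.

(** * Complex derivatives and closed forms *)

Section ComplexDeriv.
Variable R : realType.
Notation C := R[i].
Notation nc := (@Normc.normc R).
Notation Re := complex.Re.
Notation Im := complex.Im.
Implicit Types (z w h : C) (H : C -> C).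

Lemma normcE z : `|z| = (nc z)%:C.
Proof. by case: z => a b; rewrite normc_def. Qed.

Lemma normc_ge0 z : 0 <= nc z.
Proof. by rewrite -ler0c -normcE. Qed.

Lemma Re_le_normc z : `|Re z| <= nc z.
Proof. by rewrite -lecR -normcE normc_ge_Re. Qed.

Lemma Im_le_normc z : `|Im z| <= nc z.
Proof.
case: z => a b /=; rewrite -sqrtr_sqr ler_wsqrtr// lerDr sqr_ge0//.
Qed.

Lemma normc_le_ReIm z : nc z <= `|Re z| + `|Im z|.
Proof.
case: z => a b /=; rewrite -[leRHS]ger0_norm ?addr_ge0// -sqrtr_sqr.
rewrite ler_wsqrtr// sqrrD !real_normK ?num_real//.
by rewrite -addrA lerD2l lerDr mulrn_wge0// mulr_ge0.
Qed.

Lemma cReD z w : Re (z + w) = Re z + Re w. Proof. by case: z; case: w. Qed.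
Lemma cImD z w : Im (z + w) = Im z + Im w. Proof. by case: z; case: w. Qed.
Lemma cReN z : Re (- z) = - Re z. Proof. by case: z. Qed.
Lemma cImN z : Im (- z) = - Im z. Proof. by case: z. Qed.
Lemma cReB z w : Re (z - w) = Re z - Re w. Proof. by rewrite cReD cReN. Qed.
Lemma cImB z w : Im (z - w) = Im z - Im w. Proof. by rewrite cImD cImN. Qed.
Lemma cReM z w : Re (z * w) = Re z * Re w - Im z * Im w.
Proof. by case: z; case: w. Qed.
Lemma cImM z w : Im (z * w) = Re z * Im w + Im z * Re w.
Proof. by case: z; case: w. Qed.

(** The norm on the complex field takes complex values; this real form of the
    derivative is the one that suits estimates. *)
Definition has_cderiv H z (L : C) := forall eps : R, 0 < eps -> exists2 dl, 0 < dl &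
  forall h, nc h < dl -> nc (H (z + h) - H z - L * h) <= eps * nc h.

Lemma cvgC_normc (T : Type) (F : set_system T) (FF : Filter F) (f : T -> C^o) (l : C^o) :
  (forall e : R, 0 < e -> \forall t \near F, nc (l - f t) <= e) <->
  f t @[t --> F] --> l.
Proof.
split.
  move=> K; apply/cvgrPdist_le => e; case: e => a b.
  rewrite ltcE /= => /andP[/eqP -> a0].
  by apply: filterS (K a a0) => t; rewrite normcE lecR.
move=> /cvgrPdist_le K e e0.
have := K e%:C; rewrite ltcR => /(_ e0).
by apply: filterS => t; rewrite normcE lecR.
Qed.

Lemma near_normc (P : C -> Prop) z0 :
  (\forall z \near (z0 : C^o), P z) <->
  exists2 d : R, 0 < d & forall z, nc (z - z0) < d -> P z.
Proof.
split.
  move=> /nbhs_ballP[e /= e0 He].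
  case: e e0 He => a b; rewrite ltcE /= => /andP[/eqP -> a0] He.
  exists a => // z ha; apply: He.
  by rewrite /ball /= -opprB normrN normcE ltcR.
move=> [d d0 Hd]; apply/nbhs_ballP; exists d%:C; first by rewrite /= ltcR.
by move=> z; rewrite /ball /= -opprB normrN normcE ltcR; exact: Hd.
Qed.

Lemma derivableP_normc H z :
  derivable (H : C^o -> C^o) z 1 <-> exists L, has_cderiv H z L.
Proof.
have quot h L : h != 0 ->
    nc (H (z + h) - H z - L * h) = nc (L - h^-1 *: (H (h *: 1 + z) - H z : C^o)) * nc h.
  move=> h0; rewrite -Normc.normcM -normcN; congr nc.
  rewrite /GRing.scale /= mulr1 (addrC h z) mulrBl [X in _ = L * h - X]mulrAC.
  by rewrite mulVf// mul1r opprB.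
split.
  move=> /cvg_ex[L /(@cvgC_normc _ _ _ _ L) K]; exists L => e e0.
  have [d d0 Hd] := (near_normc _ _).1 (K e e0).
  exists d => // h hd; have {}Hd := Hd h; rewrite subr0 in Hd.
  have [->|h0] := eqVneq h 0.
    by rewrite addr0 subrr mulr0 subrr Normc.normc0 mulr0.
  by rewrite quot// ler_wpM2r ?normc_ge0//; exact: Hd.
move=> [L HL]; apply/cvg_ex; exists L; apply/cvgC_normc => e e0.
have [d d0 Hd] := HL e e0.
apply/near_normc; exists d => // h; rewrite subr0 => hd h0.
have := Hd h hd; rewrite quot// ler_pM2r//.
by rewrite lt_neqAle normc_ge0 andbT eq_sym; apply/eqP => /Normc.eq0_normc; exact/eqP.
Qed.

(** With [H = u + i v], the form is [Re (H dz) = u dx - v dy], and the condition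
    on its derivatives is a Cauchy-Riemann equation. *)
Lemma has_cderiv_closed_at H x y L : has_cderiv H (x +i* y) L ->
  closed_at (fun s t => Re (H (s +i* t))) (fun s t => - Im (H (s +i* t))) x y.
Proof.
move=> HL; exists (Re L), (- Im L), (- Re L) => e e0.
have [d d0 Hd] := HL e e0.
exists (d / 2); first by rewrite divr_gt0.
move=> h k hd kd.
have hk : nc (h +i* k) <= `|h| + `|k| by exact: normc_le_ReIm.
have {}Hd := Hd (h +i* k) ltac:(lra).
have {}Hd : nc (H ((x + h) +i* (y + k)) - H (x +i* y) - L * (h +i* k)) <= e * (`|h| + `|k|).
  by apply: le_trans Hd _; rewrite ler_pM2l.
split; apply: le_trans Hd.
  apply: le_trans (Re_le_normc _); rewrite !cReB cReM /=.
  by rewrite le_eqVlt; apply/orP; left; apply/eqP; congr (`|_|); ring.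
apply: le_trans (Im_le_normc _); rewrite !cImB cImM /=.
by rewrite -normrN le_eqVlt; apply/orP; left; apply/eqP; congr (`|_|); ring.
Qed.

End ComplexDeriv.

(** * The Poisson kernel *)

Section Kernel.
Variable R : realType.
Notation mu := (@lebesgue_measure R).

Lemma ae_imp (P Q : R -> Prop) : (forall t, P t -> Q t) ->
  {ae mu, forall t, P t} -> {ae mu, forall t, Q t}.
Proof. exact: (@filterS _ _ (ae_filter_ringOfSetsType mu)). Qed.

Lemma ae_imp2 (P Q S : R -> Prop) : (forall t, P t -> Q t -> S t) ->
  {ae mu, forall t, P t} -> {ae mu, forall t, Q t} -> {ae mu, forall t, S t}.
Proof. exact: (@filterS2 _ _ (ae_filter_ringOfSetsType mu)). Qed.

Lemma Rintegral_dominated_cvg (f_ : nat -> R -> R) (f g : R -> R) :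
  (forall n, measurable_fun setT (f_ n)) -> measurable_fun setT f ->
  {ae mu, forall t, f_ n t @[n --> \oo] --> f t} ->
  mu.-integrable setT (EFin \o g) ->
  (forall n t, `|f_ n t| <= g t) ->
  \int[mu]_t f_ n t @[n --> \oo] --> \int[mu]_t f t.
Proof.
move=> mf_ mf ff ig fg.
have [|||||fi _ H] := @dominated_convergence _ _ R mu setT measurableT
  (fun n => EFin \o f_ n) (EFin \o f) (EFin \o g).
- by move=> n; apply/measurable_EFinP; exact: mf_.
- exact/measurable_EFinP.
- move: ff; apply: ae_imp => t H _; apply: cvg_EFin H; exact: nearW.
- by [].
- by apply: aeW => t n _ /=; rewrite lee_fin.
apply: fine_cvg; rewrite fineK//; exact: integrable_fin_num.
Qed.

Implicit Types x y t : R.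

Definition poisson_kernel (x y t : R) := y / ((t - x) ^+ 2 + y ^+ 2).

Lemma poisson_den_gt0 x y t : 0 < y -> 0 < (t - x) ^+ 2 + y ^+ 2.
Proof. by move=> y0; rewrite ltr_wpDl ?sqr_ge0// exprn_gt0. Qed.

Lemma poisson_kernel_gt0 x y t : 0 < y -> 0 < poisson_kernel x y t.
Proof. by move=> y0; rewrite divr_gt0// poisson_den_gt0. Qed.

Lemma poisson_kernel_continuous x y : 0 < y -> continuous (poisson_kernel x y).
Proof.
move=> y0 t; apply: cvgM; first exact: cvg_cst.
apply: cvgV; first by rewrite gt_eqF// poisson_den_gt0.
apply: cvgD; last exact: cvg_cst.
have sub : t' - x @[t' --> t] --> t - x by apply: cvgB; [exact: cvg_id|exact: cvg_cst].
exact: (cvgM sub sub).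
Qed.

Lemma integral_oneDsqrV : (\int[mu]_t ((@oneDsqr R t)^-1)%:E)%E = (pi : R)%:E.
Proof.
rewrite (@ge0_symfun_integralT R (fun t => (oneDsqr t)^-1)).
- rewrite -set_itvcy integral0y_oneDsqr -EFinM; congr (_%:E).
  by field.
- by move=> t; rewrite invr_ge0.
- exact: continuous_oneDsqrV.
- by move=> t /=; rewrite /oneDsqr sqrrN.
Qed.

(** The substitution [t -> (t - x) / y] leads to the integral of [1 / (1 + t^2)]. *)
Lemma integral_poisson_kernel x y : 0 < y ->
  (\int[mu]_t (poisson_kernel x y t)%:E)%E = (pi : R)%:E.
Proof.
move=> y0.
pose F t : R := y^-1 *: (t - x).
have dF t : is_derive t 1 F y^-1.
  by apply: is_derive_eq; rewrite /GRing.scale /= subr0 mulr1.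
have F' : derive1 F = cst y^-1.
  by apply/funext => t; rewrite derive1E derive_val.
have := @increasing_ge0_integration_by_substitutionT R F (fun t => (oneDsqr t)^-1).
rewrite integral_oneDsqrV F' => ->.
- apply: eq_integral => t _; congr (_%:E); rewrite /poisson_kernel /oneDsqr.
  have d0 := poisson_den_gt0 x t y0.
  have e : 1 + F t ^+ 2 = ((t - x) ^+ 2 + y ^+ 2) / y ^+ 2.
    by rewrite /F /GRing.scale /= exprMn exprVn; field; rewrite gt_eqF.
  rewrite [RHS](_ : _ = (1 + F t ^+ 2)^-1 * y^-1)// e invf_div.
  by field; rewrite !gt_eqF.
- by move=> s t st; rewrite /F /GRing.scale /= ltr_pM2l ?invr_gt0// ltrD2r.
- exact: cst_continuous.
- exact: is_cvg_cst.
- exact: is_cvg_cst.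
- by move=> t; exact: ex_derive.
- apply/cvgrNyPle => A; near=> t.
  rewrite /F /GRing.scale /= mulrC ler_pdivrMr// lerBlDr.
  by near: t; apply: nbhs_ninfty_le; exact: num_real.
- apply/cvgryPge => A; near=> t.
  rewrite /F /GRing.scale /= mulrC ler_pdivlMr// lerBrDr.
  by near: t; apply: nbhs_pinfty_ge; exact: num_real.
- exact: continuous_oneDsqrV.
- by move=> t; rewrite invr_ge0.
Unshelve. all: by end_near. Qed.

Lemma integrable_poisson_kernel x y : 0 < y ->
  mu.-integrable setT (EFin \o poisson_kernel x y).
Proof.
move=> y0; apply/integrableP; split.
  apply/measurable_EFinP; apply: continuous_measurable_fun.
  exact: poisson_kernel_continuous.
rewrite (_ : (\int[mu]_t _)%E = (pi : R)%:E) ?ltry//.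
rewrite -(integral_poisson_kernel x y0); apply: eq_integral => t _ /=.
by rewrite ger0_norm// ltW// poisson_kernel_gt0.
Qed.

Lemma Rintegral_poisson_kernel x y : 0 < y ->
  \int[mu]_t poisson_kernel x y t = pi.
Proof. by move=> y0; rewrite /Rintegral integral_poisson_kernel. Qed.

Lemma integrable_mul_poisson (f : R -> R) x y (M : R) : 0 < y -> continuous f ->
  (forall t, `|f t| <= M) ->
  mu.-integrable setT (EFin \o (fun t => f t * poisson_kernel x y t)).
Proof.
move=> y0 cf fM.
apply: (@le_integrable _ _ _ mu setT measurableT _ (EFin \o (fun t => M * poisson_kernel x y t))).
- apply/measurable_EFinP; apply: continuous_measurable_fun => t.
  by apply: cvgM; [exact: cf|exact: poisson_kernel_continuous].
- move=> t _ /=; rewrite lee_fin !normrM ler_wpM2r//.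
  by rewrite (le_trans (fM t))// ler_norm.
- exact: (integrableZl measurableT M (integrable_poisson_kernel x y0)).
Qed.

End Kernel.

(** * Complex differentiation and the truncated Poisson formula *)

Section TruncatedPoisson.
Variable R : realType.
Notation mu := (@lebesgue_measure R).
Notation C := R[i].
Notation nc := (@Normc.normc R).
Notation Re := complex.Re.
Notation Im := complex.Im.
Notation cderivable F z := (derivable ((F : C -> C) : C^o -> C^o) z 1).
Implicit Types (F G : C -> C) (z w : C).

(** Rules for complex derivatives, with the complex field seen as a normed module
    over itself on both sides. *)
Lemma cderivable_cst c z : cderivable (fun=> c) z.
Proof. exact: (@derivable_cst _ C^o C^o). Qed.

Lemma cderivable_id z : cderivable id z.
Proof. exact: (@derivable_id _ C^o). Qed.

Lemma cderivableD F G z : cderivable F z -> cderivable G z ->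
  cderivable (fun x => F x + G x) z.
Proof. exact: (@derivableD _ C^o C^o F G). Qed.

Lemma cderivableB F G z : cderivable F z -> cderivable G z ->
  cderivable (fun x => F x - G x) z.
Proof. exact: (@derivableB _ C^o C^o F G). Qed.

Lemma cderivableM F G z : cderivable F z -> cderivable G z ->
  cderivable (fun x => F x * G x) z.
Proof. exact: (@derivableM _ C^o F G). Qed.

Lemma cderivableV F z : F z != 0 -> cderivable F z ->
  cderivable (fun x => (F x)^-1) z.
Proof. exact: (@derivableV _ C^o F). Qed.

Lemma cderivable_shift F z w : cderivable F (z + w) ->
  cderivable (fun x => F (x + w)) z.
Proof.
move=> /derivableP_normc[L HL]; apply/derivableP_normc; exists L => e e0.
by have [d d0 Hd] := HL e e0; exists d => // h hd; rewrite (addrAC z h w); exact: Hd.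
Qed.

Lemma cderivable_closed_at F x y : cderivable F (x +i* y) ->
  closed_at (fun s t => Re (F (s +i* t))) (fun s t => - Im (F (s +i* t))) x y.
Proof. by move=> /derivableP_normc[L]; exact: has_cderiv_closed_at. Qed.

Lemma cderivable_horizontal_continuous F x y : cderivable F (x +i* y) ->
  {for x, continuous (fun t => Re (F (t +i* y)))}.
Proof. by move=> /cderivable_closed_at/closed_at_cont[]. Qed.

Lemma normcB z w : nc (z - w) <= nc z + nc w.
Proof. by rewrite -(normcN w); exact: le_normcD. Qed.

Lemma normcB_ge z w : nc z - nc w <= nc (z - w).
Proof. by rewrite lerBlDr -{1}(subrK w z); exact: le_normcD. Qed.

Lemma normc_real (a : R) : nc a%:C = `|a|.
Proof. by rewrite /= expr0n addr0 sqrtr_sqr. Qed.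

Lemma normcX2 z : nc z ^+ 2 = Re z ^+ 2 + Im z ^+ 2.
Proof. by case: z => a b /=; rewrite sqr_sqrtr// addr_ge0// sqr_ge0. Qed.

(** The quotient H below is analytic in the closed half-plane except at z, where
    it stays bounded, so its integral over [[x - T, x + T] x [0, T]] is 0.  On the
    line its real part is the integrand; on the three other sides, of total
    length [4 T], it is at most [4 M y / T^2]. *)
Lemma poisson_truncated (K : C -> C) (M x y : R) : 0 < y ->
  (forall z, 0 <= Im z -> cderivable K z) ->
  (forall z, 0 <= Im z -> nc (K z) <= M) ->
  forall T, 2 * y <= T ->
  `|\int[mu]_(t in `[x - T, x + T])
      ((Re (K (t +i* 0)) - Re (K (x +i* y))) * poisson_kernel x y t)|
    <= 16 * M * y / T.
Proof.
move=> y0 dK bK T yT.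
set z : C := x +i* y.
have T0 : 0 < T by lra.
(* This is [(w - z) (w - conj z)], in a form that is visibly real on the line. *)
pose D w : C := (w - x%:C) * (w - x%:C) + (y ^+ 2)%:C.
pose H w : C := (K w - K z) / D w * y%:C.
have DE w : D w = (w - z) * (w - (x +i* (- y))).
  case: w => a b; rewrite /D /z; apply/eqP; rewrite eq_complex /=.
  by apply/andP; split; apply/eqP; ring.
have D0 w : 0 <= Im w -> w != z -> D w != 0.
  move=> w0 wz; rewrite DE mulf_neq0 ?subr_eq0//.
  apply/eqP => e; move: w0; rewrite e /=; lra.
have dH w : 0 <= Im w -> w != z -> cderivable H w.
  move=> w0 wz; apply: cderivableM; last exact: cderivable_cst.
  apply: cderivableM.
    by apply: cderivableB; [exact: dK|exact: cderivable_cst].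
  apply: cderivableV; first exact: D0.
  apply: cderivableD; last exact: cderivable_cst.
  by apply: cderivableM; apply: cderivableB; [exact: cderivable_id|exact: cderivable_cst|exact: cderivable_id|exact: cderivable_cst].
(* Far from the pole, [|D w| >= T^2 - y^2 >= T^2 / 2]. *)
have bH w : 0 <= Im w -> T <= nc (w - x%:C) -> nc (H w) <= 4 * M * y / T ^+ 2.
  move=> w0 wT.
  have M0 : nc (K w - K z) <= 2 * M.
    have := bK z ltac:(by rewrite /= ltW); have := bK w w0.
    have := normcB (K w) (K z); lra.
  have T2 : 2 * y * (2 * y) <= T * T by rewrite ler_pM//; lra.
  have dT : T ^+ 2 / 2 <= nc (D w).
    have := normcB_ge ((w - x%:C) * (w - x%:C)) (- (y ^+ 2)%:C).
    rewrite opprK normcN normc_real ger0_norm ?sqr_ge0// Normc.normcM.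
    have : T * T <= nc (w - x%:C) * nc (w - x%:C) by rewrite ler_pM//; lra.
    rewrite /D !expr2 => h1 h2; apply: le_trans h2; have := sqr_ge0 y; rewrite expr2; lra.
  have dT0 : 0 < T ^+ 2 / 2 by rewrite divr_gt0// exprn_gt0.
  rewrite /H !Normc.normcM Normc.normcV normc_real (gtr0_norm y0).
  have -> : 4 * M * y / T ^+ 2 = 2 * M / (T ^+ 2 / 2) * y by field; lra.
  rewrite ler_pM2r// ler_pM ?normc_ge0 ?invr_ge0 ?normc_ge0//.
  by rewrite lef_pV2// posrE (lt_le_trans dT0).
(* Near the pole, the numerator is [O(|w - z|)] and [|w - conj z| >= y]. *)
have [r r0 [k Hk]] : exists2 r, 0 < r & exists k, forall w, nc (w - z) <= r -> w != z ->
    nc (H w) <= k.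
  have [L /(_ 1 ltr01)[d d0 Hd]] := (derivableP_normc K z).1 (dK z ltac:(by rewrite /= ltW)).
  exists (Num.min (d / 2) y); first by rewrite lt_min y0 divr_gt0.
  exists (1 + nc L) => w; rewrite le_min => /andP[h1 h2] wz.
  have num : nc (K w - K z) <= (1 + nc L) * nc (w - z).
    have := Hd (w - z) ltac:(lra); rewrite (addrC z) subrK.
    have := le_normcD (K w - K z - L * (w - z)) (L * (w - z)).
    rewrite subrK Normc.normcM; lra.
  have wzbar : y <= nc (w - (x +i* (- y))).
    have := le_trans (Im_le_normc _) h2; rewrite cImB /= ler_norml => /andP[h3 _].
    apply: le_trans (Im_le_normc _); rewrite cImB /= opprK ler_normr; apply/orP; left; lra.
  have wz0 : 0 < nc (w - z).
    rewrite lt_neqAle normc_ge0 andbT eq_sym; apply/eqP => /Normc.eq0_normc/eqP.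
    by rewrite subr_eq0 (negbTE wz).
  rewrite /H DE !Normc.normcM Normc.normcV Normc.normcM normc_real (gtr0_norm y0).
  have wb0 : 0 < nc (w - (x +i* (- y))) by exact: lt_le_trans wzbar.
  rewrite (_ : _ * y = (nc (K w - K z) / nc (w - z)) * (y / nc (w - (x +i* (- y))))); last first.
    by rewrite invfM; ring.
  rewrite -[leRHS]mulr1 ler_pM ?divr_ge0 ?normc_ge0 ?(ltW y0)//.
    by rewrite ler_pdivrMr.
  by rewrite ler_pdivrMr// mul1r.
pose p s t := Re (H (s +i* t)).
pose q s t := - Im (H (s +i* t)).
have I0 : oint p q (x - T) (x + T) 0 T = 0.
  apply: (@goursat_puncture _ p q _ _ _ _ x y (r / 2) k); try lra.
  - move=> s t _ /andP[t0 _] st; apply: cderivable_closed_at; apply: dH => //.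
    by apply: contra st => /eqP[-> ->].
  - move=> s t sx ty st.
    have : nc (H (s +i* t)) <= k.
      apply: Hk; last by apply: contra st => /eqP[-> ->].
      apply: le_trans (normc_le_ReIm _) _; rewrite /z /=; lra.
    by move=> h; split; [apply: le_trans h; exact: Re_le_normc|rewrite normrN; apply: le_trans h; exact: Im_le_normc].
have cp t : 0 <= t -> t != y -> cont_on (fun s => p s t) (x - T) (x + T).
  move=> t0 ty s _; apply: cderivable_horizontal_continuous; apply: dH => //.
  by apply: contra ty => /eqP[_ ->].
have Hz t : Re (H (t +i* 0)) = (Re (K (t +i* 0)) - Re (K z)) * poisson_kernel x y t.
  have -> : H (t +i* 0) = (K (t +i* 0) - K z) * (poisson_kernel x y t)%:C.
    rewrite /H (_ : D _ = ((t - x) ^+ 2 + y ^+ 2)%:C); last first.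
      by rewrite /D; apply/eqP; rewrite eq_complex /=; apply/andP; split; apply/eqP; ring.
    by rewrite -fmorphV -mulrA -rmorphM /= [_ * y]mulrC.
  by rewrite cReM /= mulr0 subr0 cReB.
have -> : \int[mu]_(t in `[x - T, x + T])
      ((Re (K (t +i* 0)) - Re (K z)) * poisson_kernel x y t) =
   \int[mu]_(t in `[x - T, x + T]) p t 0.
  by apply: eq_Rintegral => t _; rewrite -Hz.
have cp0 : cont_on (fun s => p s 0) (x - T) (x + T) by apply: cp => //; rewrite lt_eqF.
have cpT : cont_on (fun s => p s T) (x - T) (x + T) by apply: cp; [lra|rewrite gt_eqF//; lra].
have cq s : s != x -> cont_on (q s) 0 T.
  move=> sx t /andP[t0 _].
  have := cderivable_closed_at (dH (s +i* t) t0 _).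
  by move=> /(_ ltac:(by apply: contra sx => /eqP[->]))/closed_at_cont[].
have cql : cont_on (q (x - T)) 0 T by apply: cq; rewrite lt_eqF//; lra.
have cqr : cont_on (q (x + T)) 0 T by apply: cq; rewrite gt_eqF//; lra.
have E1 := Rintegral_seg_B cp0 cpT.
move: I0; rewrite /oint E1 => I0.
set B := 4 * M * y / T ^+ 2 in bH.
have top : `|\int[mu]_(s in `[x - T, x + T]) p s T| <= B * (x + T - (x - T)).
  apply: Rintegral_seg_le => //; first lra.
  move=> s _; apply: le_trans (Re_le_normc _) _; apply: bH; first by rewrite /= ltW.
  by apply: le_trans (Im_le_normc _); rewrite cImB /= subr0 gtr0_norm.
have side : `|\int[mu]_(t in `[0, T]) (q (x + T) t - q (x - T) t)| <= 2 * B * (T - 0).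
  apply: Rintegral_seg_le; [lra|exact: cont_onB|].
  have qB s t : 0 <= t -> `|s - x| = T -> `|q s t| <= B.
    move=> t0 sx; rewrite normrN; apply: le_trans (Im_le_normc _) _; apply: bH => //.
    by apply: le_trans (Re_le_normc _); rewrite cReB /= sx.
  move=> t /andP[t0 _]; rewrite (le_trans (ler_normB _ _))//.
  have := qB (x + T) t t0; have := qB (x - T) t t0.
  have -> : x + T - x = T by ring.
  have -> : x - T - x = - T by ring.
  by rewrite normrN gtr0_norm// => /(_ erefl) h1 /(_ erefl) h2; lra.
have -> : 16 * M * y / T = B * (x + T - (x - T)) + 2 * B * (T - 0).
  by rewrite /B; field; lra.
have -> : \int[mu]_(t in `[x - T, x + T]) p t 0 =
  \int[mu]_(s in `[x - T, x + T]) p s T - \int[mu]_(t in `[0, T]) (q (x + T) t - q (x - T) t).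
  by move: I0; rewrite addrAC => /eqP; rewrite subr_eq0 => /eqP <-; rewrite addrK.
by apply: le_trans (ler_normB _ _) _; exact: lerD.
Qed.

End TruncatedPoisson.

(** * The Poisson formula *)

Section Poisson.
Variable R : realType.
Notation mu := (@lebesgue_measure R).
Notation C := R[i].
Notation nc := (@Normc.normc R).
Notation Re := complex.Re.
Notation Im := complex.Im.
Notation cderivable F z := (derivable ((F : C -> C) : C^o -> C^o) z 1).
Implicit Types (F G : C -> C) (z w : C).

Lemma Rintegral_expanding (g : R -> R) x : mu.-integrable setT (EFin \o g) ->
  \int[mu]_(t in `[x - n%:R, x + n%:R]) g t @[n --> \oo] --> \int[mu]_t g t.
Proof.
move=> ig.
have mg : measurable_fun setT g by apply/measurable_EFinP; case/integrableP: ig.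
have -> : (fun n : nat => \int[mu]_(t in `[x - n%:R, x + n%:R]) g t) =
    (fun n : nat => \int[mu]_t (g \_ `[x - n%:R, x + n%:R]) t).
  by apply/funext => n; rewrite Rintegral_mkcond.
apply: (@Rintegral_dominated_cvg _ _ _ (fun t => `|g t|)).
- move=> n; apply: (measurable_restrictT g _).1; first exact: measurable_itv.
  exact: measurable_funTS.
- exact: mg.
- apply: aeW => t; apply: cvg_near_cst; near=> n.
  rewrite patchE ifT// inE /= in_itv /=.
  have : `|t - x| <= n%:R by near: n; exact: nbhs_infty_ger.
  by rewrite ler_norml; lra.
- exact: (integrable_norm ig).
- by move=> n t; rewrite patchE; case: ifP => // _; rewrite normr0.
Unshelve. all: by end_near. Qed.

(** Poisson formula with the values of F at height c, inside the domain, so that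
    no boundary behaviour is involved; it is the limit of [poisson_truncated]. *)
Theorem poisson_formula F (M x y c : R) : analytic_on (@upper_half R) F ->
  (forall z, 0 < Im z -> nc (F z) <= M) -> 0 < y -> 0 < c ->
  \int[mu]_t (Re (F (t +i* c)) * poisson_kernel x y t) =
  pi * Re (F (x +i* (y + c))).
Proof.
move=> aF bF y0 c0.
pose K z := F (z + 0 +i* c).
have KE s t : K (s +i* t) = F (s +i* (t + c)).
  by congr F; apply/eqP; rewrite eq_complex /= addr0 !eqxx.
have dK z : 0 <= Im z -> cderivable K z.
  move=> z0; apply: cderivable_shift; apply: aF.
  by rewrite /upper_half /= cImD /= ltr_wpDl.
have bK z : 0 <= Im z -> nc (K z) <= M.
  by move=> z0; apply: bF; rewrite cImD /= ltr_wpDl.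
have cK : continuous (fun t => Re (F (t +i* c))).
  by move=> t; apply: cderivable_horizontal_continuous; exact: aF.
have iFP : mu.-integrable setT (EFin \o (fun t => Re (F (t +i* c)) * poisson_kernel x y t)).
  apply: (@integrable_mul_poisson _ _ x y M y0 cK) => t.
  by apply: le_trans (Re_le_normc _) _; exact: bF.
have icP : mu.-integrable setT
    (EFin \o (fun t => Re (F (x +i* (y + c))) * poisson_kernel x y t)).
  apply: (@integrable_mul_poisson _ (fun=> Re (F (x +i* (y + c)))) x y M y0).
    by move=> ?; exact: cst_continuous.
  by move=> t; apply: le_trans (Re_le_normc _) _; apply: bF => /=; rewrite addr_gt0.
have iD := integrableB measurableT iFP icP.
have L1 := Rintegral_expanding x iD.
have L2 : \int[mu]_(t in `[x - n%:R, x + n%:R])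
   (Re (F (t +i* c)) * poisson_kernel x y t - Re (F (x +i* (y + c))) * poisson_kernel x y t)
    @[n --> \oo] --> 0.
  apply/cvgrPdist_le => e e0; near=> n.
  have n1 : 2 * y <= n%:R by near: n; exact: nbhs_infty_ger.
  have n2 : 16 * M * y / e <= n%:R by near: n; exact: nbhs_infty_ger.
  have n0 : 0 < n%:R :> R by lra.
  rewrite sub0r normrN.
  apply: (@le_trans _ _ (16 * M * y / n%:R)); last first.
    by rewrite ler_pdivrMr// [e * _]mulrC -ler_pdivrMr//.
  have := @poisson_truncated _ K M x y y0 dK bK _ n1.
  congr (`|_| <= _); apply: eq_Rintegral => t _.
  by rewrite !KE add0r mulrBl.
have := cvg_unique (@Rhausdorff R) L1 L2.
rewrite RintegralB// => /(_ _) E; rewrite (subr0_eq E).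
rewrite RintegralZl//; last exact: integrable_poisson_kernel.
by rewrite Rintegral_poisson_kernel// mulrC.
Unshelve. all: by end_near. Qed.

End Poisson.

(** * A Liouville theorem for boundary values *)

Section Liouville.
Variable R : realType.
Notation mu := (@lebesgue_measure R).
Notation C := R[i].
Notation nc := (@Normc.normc R).
Notation Re := complex.Re.
Notation Im := complex.Im.
Notation cderivable F z := (derivable ((F : C -> C) : C^o -> C^o) z 1).
Implicit Types (F G : C -> C) (z w : C).

Lemma nontangential_limitP U F x w : nontangential_limit U F x w <->
  forall a : R, 0 < a -> forall e, 0 < e -> exists2 d, 0 < d &
  forall z, U z -> `|Re z - x| <= a * `|Im z| -> nc (z - x%:C) < d -> nc (w - F z) <= e.
Proof.
split=> [H a a0 e e0|H a a0].
  have /cvgC_normc/(_ e e0)/near_normc[d d0 Hd] := H a a0.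
  by exists d => // z Uz az zd; apply: (Hd z zd).
apply/cvgC_normc => e e0; apply/near_normc.
by have [d d0 Hd] := H a a0 e e0; exists d => // z zd [Uz az]; exact: Hd.
Qed.

Lemma bounded_fun_onP U F : bounded_fun_on U F <->
  exists M, forall z, U z -> nc (F z) <= M.
Proof.
split=> -[M H]; exists M => z /H; last by rewrite normcE lecR.
by rewrite normcE lecR.
Qed.

Lemma normc_conj z : nc (conjc z) = nc z.
Proof. by case: z => a b /=; rewrite sqrrN. Qed.

Lemma cderivable_conj G z : cderivable G (conjc z) -> cderivable (fun w => conjc (G (conjc w))) z.
Proof.
move=> /derivableP_normc[L HL]; apply/derivableP_normc; exists (conjc L) => e e0.
have [d d0 Hd] := HL e e0; exists d => // h hd.
rewrite -(normc_conj h) in hd *.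
rewrite (_ : _ - _ = conjc (G (conjc z + conjc h) - G (conjc z) - L * conjc h)); first by rewrite normc_conj; exact: Hd.
by rewrite !rmorphB rmorphM /= conjcK rmorphD.
Qed.

Lemma cderivable_normc_continuous F z : cderivable F z ->
  forall e, 0 < e -> exists2 d, 0 < d & forall h, nc h < d -> nc (F (z + h) - F z) <= e.
Proof.
move=> /derivableP_normc[L /(_ 1 ltr01)[d d0 Hd]] e e0.
have L0 : 0 < 1 + nc L by rewrite ltr_wpDr ?normc_ge0.
exists (Num.min d (e / (1 + nc L))); first by rewrite lt_min d0 divr_gt0.
move=> h; rewrite lt_min => /andP[/Hd h1 h2].
have := le_normcD (F (z + h) - F z - L * h) (L * h).
rewrite subrK Normc.normcM => /le_trans; apply.
have : nc h * (1 + nc L) <= e by rewrite -ler_pdivlMr// ltW.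
lra.
Qed.

(** F and the reflection of G are the Poisson integrals of their values at height
    [1 / (n + 1)].  Dominated convergence is applied to the difference of these
    values, which tends to 0 almost everywhere, because f itself may fail to be
    Borel measurable. *)
Lemma Re_upper_eq_lower F G (f : R -> C) (M x y : R) :
  analytic_on (@upper_half R) F -> analytic_on (@lower_half R) G ->
  (forall z, 0 < Im z -> nc (F z) <= M) -> (forall z, Im z < 0 -> nc (G z) <= M) ->
  {ae mu, forall t, nontangential_limit (@upper_half R) F t (f t)} ->
  {ae mu, forall t, nontangential_limit (@lower_half R) G t (f t)} ->
  0 < y -> Re (F (x +i* y)) = Re (G (x +i* (- y))).
Proof.
move=> aF aG bF bG lF lG y0.
pose G' z := conjc (G (conjc z)).
have aG' : analytic_on (@upper_half R) G'.
  move=> z z0; apply: cderivable_conj; apply: aG.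
  by move: z0; rewrite /upper_half /lower_half /=; case: z => a b /=; rewrite oppr_lt0.
have bG' z : 0 < Im z -> nc (G' z) <= M.
  by move=> z0; rewrite normc_conj; apply: bG; case: z z0 => a b /=; rewrite oppr_lt0.
have ReG' s t : Re (G' (s +i* t)) = Re (G (s +i* (- t))).
  by rewrite /G' /=; case: (G _).
pose c (n : nat) : R := n.+1%:R^-1.
have c0 n : 0 < c n by rewrite invr_gt0.
have cc : c n @[n --> \oo] --> 0 by exact: cvg_harmonic.
pose D s t := Re (F (s +i* t)) - Re (G' (s +i* t)).
have cF n : continuous (fun t => Re (F (t +i* c n))).
  by move=> t; apply: cderivable_horizontal_continuous; apply: aF; exact: c0.
have cG n : continuous (fun t => Re (G' (t +i* c n))).
  by move=> t; apply: cderivable_horizontal_continuous; apply: aG'; exact: c0.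
have cP := @poisson_kernel_continuous _ x y y0.
have iM K n : (forall z, 0 < Im z -> nc (K z) <= M) -> continuous (fun t => Re (K (t +i* c n))) ->
    mu.-integrable setT (EFin \o (fun t => Re (K (t +i* c n)) * poisson_kernel x y t)).
  move=> bK cK; apply: (@integrable_mul_poisson _ _ x y M y0 cK) => t.
  by apply: le_trans (Re_le_normc _) _; apply: bK; exact: c0.
have ID n : \int[mu]_t (D t (c n) * poisson_kernel x y t) = pi * D x (y + c n).
  rewrite /D mulrBr -(poisson_formula x aF bF y0 (c0 n)) -(poisson_formula x aG' bG' y0 (c0 n)).
  rewrite -RintegralB//; [|exact: iM|exact: iM].
  by apply: eq_Rintegral => t _; rewrite mulrBl.
have radial U K t w (s : R) : `|s| = 1 -> (forall n, U (t +i* (s * c n))) ->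
    nontangential_limit U K t w -> Re (K (t +i* (s * c n))) @[n --> \oo] --> Re w.
  move=> s1 Ut /nontangential_limitP/(_ 1 ltr01) H.
  apply/cvgrPdist_le => e /H[d d0 Hd].
  have := cc => /cvgrPdist_lt/(_ d d0); apply: filterS => n; rewrite sub0r normrN => cd.
  rewrite -cReB; apply: le_trans (Re_le_normc _) _; apply: Hd => //=.
    by rewrite subrr normr0 mul1r.
  by rewrite !subr0 subrr expr0n add0r sqrtr_sqr normrM s1 mul1r.
have L0 : \int[mu]_t (D t (c n) * poisson_kernel x y t) @[n --> \oo] --> \int[mu]_(t in setT) (0 : R).
  apply: (@Rintegral_dominated_cvg _ _ _ (fun t => 2 * M * poisson_kernel x y t)).
  - move=> n; apply: continuous_measurable_fun => t.
    by apply: cvgM; [apply: cvgB; [exact: cF|exact: cG]|exact: cP].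
  - exact: measurable_cst.
  - apply: ae_imp2 lF lG => t /(radial _ _ _ _ 1) h1 /(radial _ _ _ _ (-1)) h2.
    have {}h1 : Re (F (t +i* c n)) @[n --> \oo] --> Re (f t).
      under eq_fun do rewrite -[c _]mul1r.
      by apply: h1; [rewrite normr1|move=> n; rewrite /upper_half /= mul1r].
    have {}h2 : Re (G' (t +i* c n)) @[n --> \oo] --> Re (f t).
      under eq_fun do rewrite ReG' -mulN1r.
      by apply: h2; [rewrite normrN1|move=> n; rewrite /lower_half /= mulN1r oppr_lt0].
    rewrite -[0](mul0r (poisson_kernel x y t)) -[X in X * _](subrr (Re (f t))).
    by apply: cvgM; [exact: cvgB|exact: cvg_cst].
  - exact: (integrableZl measurableT (2 * M) (integrable_poisson_kernel x y0)).
  - move=> n t; rewrite normrM (gtr0_norm (poisson_kernel_gt0 x t y0)).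
    rewrite ler_pM2r ?poisson_kernel_gt0// (le_trans (ler_normB _ _))//.
    have := le_trans (Re_le_normc _) (bF (t +i* c n) (c0 n)).
    have := le_trans (Re_le_normc _) (bG' (t +i* c n) (c0 n)); lra.
have L1 : \int[mu]_t (D t (c n) * poisson_kernel x y t) @[n --> \oo] --> pi * D x y.
  under eq_fun do rewrite ID.
  have cont K : cderivable K (x +i* y) -> Re (K (x +i* (y + c n))) @[n --> \oo] --> Re (K (x +i* y)).
    move=> dK; apply/cvgrPdist_le => e e0.
    have [d d0 Hd] := cderivable_normc_continuous dK e0.
    have := cc => /cvgrPdist_lt/(_ d d0); apply: filterS => n; rewrite sub0r normrN => cd.
    rewrite distrC -cReB; apply: le_trans (Re_le_normc _) _.
    have := Hd (0 +i* c n).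
    rewrite [X in K X - _](_ : _ = x +i* (y + c n)); last by rewrite /= ; congr (_ +i* _); rewrite addr0.
    by apply; rewrite /= expr0n add0r sqrtr_sqr.
  apply: cvgM; first exact: cvg_cst.
  by apply: cvgB; apply: cont; [exact: aF|exact: aG'].
have := cvg_unique (@Rhausdorff R) L0 L1 => /(_ _).
rewrite Rintegral_cst// mul0r => E.
have : D x y = 0 by apply: (mulfI (lt0r_neq0 (pi_gt0 R))); rewrite mulr0 E.
by rewrite /D ReG' => /subr0_eq.
Qed.


(** Imaginary parts become real parts after multiplication by [- i]. *)
Lemma upper_eq_lower F G (f : R -> C) :
  analytic_on (@upper_half R) F -> analytic_on (@lower_half R) G ->
  bounded_fun_on (@upper_half R) F -> bounded_fun_on (@lower_half R) G ->
  {ae mu, forall t, nontangential_limit (@upper_half R) F t (f t)} ->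
  {ae mu, forall t, nontangential_limit (@lower_half R) G t (f t)} ->
  forall z, 0 < Im z -> F z = G (conjc z).
Proof.
move=> aF aG /bounded_fun_onP[M1 bF] /bounded_fun_onP[M2 bG] lF lG [x y] /= y0.
have bF' z : 0 < Im z -> nc (F z) <= Num.max M1 M2 by move=> z0; rewrite le_max bF.
have bG' z : Im z < 0 -> nc (G z) <= Num.max M1 M2 by move=> z0; rewrite le_max bG// orbT.
have rot U K (aK : analytic_on U K) : analytic_on U (fun z => (0 +i* (-1)) * K z).
  by move=> z /aK; apply: cderivableM; exact: cderivable_cst.
have n1 : nc (0 +i* (-1)) = 1 by rewrite /= expr0n add0r sqrrN expr1n sqrtr1.
have rotl U K t w : nontangential_limit U K t w ->
    nontangential_limit U (fun z => (0 +i* (-1)) * K z) t ((0 +i* (-1)) * w).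
  move=> /nontangential_limitP H; apply/nontangential_limitP => a a0 e e0.
  have [d d0 Hd] := H a a0 e e0; exists d => // z Uz az zd.
  by rewrite -mulrBr Normc.normcM n1 mul1r; exact: Hd.
have E1 := Re_upper_eq_lower x aF aG bF' bG' lF lG y0.
have E2 : Im (F (x +i* y)) = Im (G (x +i* (- y))).
  have ImE w : Im w = Re ((0 +i* (-1)) * w) by rewrite cReM /= mul0r mulN1r sub0r opprK.
  have bF1 z : 0 < Im z -> nc ((0 +i* (-1)) * F z) <= Num.max M1 M2.
    by move=> z0; rewrite Normc.normcM n1 mul1r; exact: bF'.
  have bG1 z : Im z < 0 -> nc ((0 +i* (-1)) * G z) <= Num.max M1 M2.
    by move=> z0; rewrite Normc.normcM n1 mul1r; exact: bG'.
  have lF1 := ae_imp (fun t => @rotl _ F t (f t)) lF.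
  have lG1 := ae_imp (fun t => @rotl _ G t (f t)) lG.
  rewrite (ImE (F _)) (ImE (G _)).
  exact: (Re_upper_eq_lower x (rot _ _ aF) (rot _ _ aG) bF1 bG1 lF1 lG1 y0).
by apply/eqP; rewrite eq_complex; apply/andP; split; apply/eqP.
Qed.

(** The increments of F at z are complex linear in h and also conjugate linear
    in h, up to o(h).  The directions [h = t] and [h = i t] show that both linear
    maps vanish. *)
Lemma cderiv_conj_eq0 F G z : 0 < Im z -> cderivable F z -> cderivable G (conjc z) ->
  (forall w, 0 < Im w -> F w = G (conjc w)) -> has_cderiv F z 0.
Proof.
move=> z0 /derivableP_normc[L HL] /derivableP_normc[L' HL'] FG.
have K e : 0 < e -> nc (L - L') <= 2 * e /\ nc (L + L') <= 2 * e.
  move=> e0; have [d1 d10 H1] := HL e e0; have [d2 d20 H2] := HL' e e0.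
  pose t := Num.min (Num.min (d1 / 2) (d2 / 2)) (Im z / 2).
  have t0 : 0 < t by rewrite !lt_min !divr_gt0.
  have : t <= t by [].
  rewrite {2}/t !le_min => /andP[/andP[t1 t2] t3].
  have H h : nc h = t -> nc (L * h - L' * conjc h) <= 2 * e * t.
    move=> ht.
    have h1 := H1 h ltac:(lra); have h2 := H2 (conjc h) ltac:(rewrite normc_conj; lra).
    have zh : 0 < Im (z + h).
      have := Im_le_normc h; rewrite ht cImD ler_norml; lra.
    have := FG _ z0; have := FG _ zh; rewrite rmorphD => e1 e2.
    rewrite e1 e2 in h1.
    move: h2; rewrite normc_conj; move: h1; rewrite ht.
    move: (G (conjc z + conjc h) - G (conjc z)) => A h1 h2.
    have -> : L * h - L' * conjc h = (A - L' * conjc h) - (A - L * h) by ring.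
    have := normcB (A - L' * conjc h) (A - L * h); lra.
  split.
    have := H t%:C; rewrite conjc_real -mulrBl Normc.normcM normc_real gtr0_norm//.
    by rewrite ler_pM2r// => /(_ erefl).
  have := H (0 +i* t).
  have -> : conjc (0 +i* t) = - (0 +i* t) by apply/eqP; rewrite eq_complex /= oppr0 !eqxx.
  rewrite mulrN opprK -mulrDl Normc.normcM.
  have -> : nc (0 +i* t) = t by rewrite /= expr0n add0r sqrtr_sqr gtr0_norm.
  by rewrite ler_pM2r// => /(_ erefl).
suff L0 : L = 0 by rewrite -L0.
apply: Normc.eq0_normc; apply/eqP; rewrite eq_le normc_ge0 andbT.
apply/ler_addgt0Pr => e e0; rewrite add0r.
have [k1 k2] := K (e / 2) ltac:(by rewrite divr_gt0).
have := le_normcD (L - L') (L + L').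
have -> : L - L' + (L + L') = 2%:R%:C * L by rewrite rmorph_nat; ring.
rewrite Normc.normcM normc_real ger0_norm//; lra.
Qed.

Lemma zero_cderiv_horizontal F y : (forall x, has_cderiv F (x +i* y) 0) ->
  forall x x', Re (F (x +i* y)) = Re (F (x' +i* y)).
Proof.
move=> H.
suff K x : is_derive x (1 : R) (fun x => Re (F (x +i* y))) (0 : R).
  by move=> x x'; exact: (is_derive_0_is_cst _ _ K).
have L : h^-1 *: (((fun x => Re (F (x +i* y))) \o shift x) (h *: 1) - Re (F (x +i* y)))
    @[h --> (0 : R)^'] --> (0 : R).
  apply/cvgrPdist_le => e e0; have [d d0 Hd] := H x e e0.
  near=> h.
  have h0 : h != 0 by near: h; exact: nbhs_dnbhs_neq.
  have hd : nc h%:C < d by rewrite normc_real; near: h; exact: dnbhs0_lt.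
  have := Hd _ hd; rewrite mul0r subr0 normc_real => K.
  rewrite sub0r normrN normrM normfV mulrC ler_pdivrMr ?normr_gt0//.
  apply: le_trans K; apply: le_trans (Re_le_normc _).
  have E : (x +i* y) + h%:C = (h *: 1 + x) +i* y.
    by apply/eqP; rewrite eq_complex /= /GRing.scale /= mulr1 addr0 addrC !eqxx.
  by rewrite E cReB.
apply: DeriveDef; first by apply/cvg_ex; exists 0; exact: L.
by apply: cvg_lim; [exact: Rhausdorff|exact: L].
Unshelve. all: by end_near. Qed.

(** When F is constant on the line at height c, the Poisson formula says that
    this constant is also the value of F at every greater height. *)
Lemma horizontal_Re_const F (M : R) : analytic_on (@upper_half R) F ->
  (forall z, 0 < Im z -> nc (F z) <= M) ->
  (forall y x x', 0 < y -> Re (F (x +i* y)) = Re (F (x' +i* y))) ->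
  forall z w, 0 < Im z -> 0 < Im w -> Re (F z) = Re (F w).
Proof.
move=> aF bF hF.
have up x y c : 0 < y -> 0 < c -> Re (F (x +i* (y + c))) = Re (F (x +i* c)).
  move=> y0 c0; have := poisson_formula x aF bF y0 c0.
  under eq_Rintegral do rewrite (hF c _ x c0).
  rewrite RintegralZl//; last exact: integrable_poisson_kernel.
  rewrite Rintegral_poisson_kernel// mulrC => E.
  exact/esym/(mulfI (lt0r_neq0 (pi_gt0 R)) E).
have lt a b a' b' : 0 < b -> b < b' -> Re (F (a +i* b)) = Re (F (a' +i* b')).
  move=> b0 bb; rewrite (hF b a a')// -(up a' (b' - b))// ?subr_gt0// subrK//.
move=> [a b] [a' b'] /= b0 b0'.
have [bb|bb|<-] := ltgtP b b'; [exact: lt|exact/esym/lt|exact: hF].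
Qed.

(** By [upper_eq_lower], F is analytic and antianalytic, so its derivative is 0. *)
Theorem hardy_liouville F G (f : R -> C) :
  analytic_on (@upper_half R) F -> analytic_on (@lower_half R) G ->
  bounded_fun_on (@upper_half R) F -> bounded_fun_on (@lower_half R) G ->
  {ae mu, forall t, nontangential_limit (@upper_half R) F t (f t)} ->
  {ae mu, forall t, nontangential_limit (@lower_half R) G t (f t)} ->
  exists c, forall z, 0 < Im z -> F z = c.
Proof.
move=> aF aG bF bG lF lG.
have E := upper_eq_lower aF aG bF bG lF lG.
have [M bM] := (bounded_fun_onP _ _).1 bF.
have D0 z : 0 < Im z -> has_cderiv F z 0.
  move=> z0; apply: (cderiv_conj_eq0 z0 _ _ E); first exact: aF.
  by apply: aG; rewrite /lower_half; case: z z0 => a b /=; rewrite oppr_lt0.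
pose c := F (0 +i* 1); exists c => z z0.
have i0 : 0 < Im (0 +i* 1 : C) by exact: ltr01.
apply/eqP; rewrite eq_complex; apply/andP; split; apply/eqP.
  apply: (horizontal_Re_const aF bM) => // y x x' y0.
  by apply: zero_cderiv_horizontal => s; exact: D0.
have n1 : nc (0 +i* (-1)) = 1 by rewrite /= expr0n add0r sqrrN expr1n sqrtr1.
have ImE w : Im (F w) = Re ((0 +i* (-1)) * F w).
  by rewrite cReM /= mul0r mulN1r sub0r opprK.
pose F' w := (0 +i* (-1)) * F w.
have aF' : analytic_on (@upper_half R) F'.
  by move=> w /aF; apply: cderivableM; exact: cderivable_cst.
have bF' w : 0 < Im w -> nc (F' w) <= M.
  by move=> w0; rewrite Normc.normcM n1 mul1r; exact: bM.
have hF' y x x' : 0 < y -> Re (F' (x +i* y)) = Re (F' (x' +i* y)).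
  move=> y0; apply: zero_cderiv_horizontal => s e e0.
  have [d d0 Hd] := D0 (s +i* y) y0 e e0; exists d => // h hd.
  rewrite /F' mul0r -mulrBr subr0 Normc.normcM n1 mul1r.
  by have := Hd h hd; rewrite mul0r subr0.
by rewrite /c (ImE z) (ImE (0 +i* 1)); exact: (horizontal_Re_const aF' bF' hF').
Qed.

End Liouville.

(** * The complex exponential *)

Section ComplexExp.
Variable R : realType.
Notation C := R[i].
Notation nc := (@Normc.normc R).
Notation Re := complex.Re.
Notation Im := complex.Im.
Notation cderivable F z := (derivable ((F : C -> C) : C^o -> C^o) z 1).
Implicit Types (F G : C -> C) (z w : C) (l : R).

(** The function [exp (i l z)], by the real exponential and Euler's formula. *)
Definition cexp l z : C := (expR (- (l * Im z)))%:C * e_ l (Re z).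

Lemma cexpD l z w : cexp l (z + w) = cexp l z * cexp l w.
Proof.
rewrite /cexp cImD cReD mulrDr opprD expRD /e_ (mulrDr l (Re z)) cosD sinD.
by apply/eqP; rewrite eq_complex /=; apply/andP; split; apply/eqP; ring.
Qed.

Lemma normc_e l x : nc (e_ l x) = 1.
Proof. by rewrite /e_ /= cos2Dsin2 sqrtr1. Qed.

Lemma normc_cexp l z : nc (cexp l z) = expR (- (l * Im z)).
Proof. by rewrite /cexp Normc.normcM normc_e mulr1 normc_real ger0_norm// expR_ge0. Qed.

Lemma cexp_real l x : cexp l (x +i* 0) = e_ l x.
Proof. by rewrite /cexp /= mulr0 oppr0 expR0 mul1r. Qed.

Lemma cexp0 l : cexp l 0 = 1.
Proof. by rewrite (cexp_real l 0) /e_ mulr0 cos0 sin0. Qed.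

Lemma is_derive_epsdelta (f : R -> R) (df : R) : is_derive (0 : R) 1 f df ->
  forall e, 0 < e -> exists2 d, 0 < d & forall t, `|t| < d ->
    `|f t - f 0 - df * t| <= e * `|t|.
Proof.
move=> /[dup] H [/cvgrPdist_le D dfE] e e0.
move: D; rewrite -[lim _]/('D_1 f 0) dfE => /(_ e e0).
move=> /nbhs_ballP[d d0 Hd]; exists d => // t td.
have [->|t0] := eqVneq t 0; first by rewrite subrr mulr0 subrr !normr0 mulr0.
have := Hd t; rewrite /ball /= sub0r normrN => /(_ td t0).
rewrite addr0 /GRing.scale /= mulr1 => K.
have -> : f t - f 0 - df * t = - (df - t^-1 * (f t - f 0)) * t.
  by rewrite mulNr mulrBl mulrAC mulVf// mul1r opprB.
by rewrite normrM normrN ler_wpM2r.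
Qed.

(** First-order expansions of exp, cos and sin at 0; the remaining terms are
    products of two first-order quantities. *)
Lemma cexp_cderiv0 l : has_cderiv (cexp l) 0 (0 +i* l).
Proof.
have dl (k : R) : is_derive (0 : R) 1 (fun b : R => k *: b) k.
  by apply: is_derive_eq; rewrite /GRing.scale /= mulr1.
have d1 : is_derive (0 : R) 1 (fun b => expR (- (l * b))) (- l).
  rewrite (_ : (fun _ => _) = expR \o (fun b : R => (- l) *: b)); last first.
    by apply/funext => b /=; rewrite /GRing.scale /= mulNr.
  by apply: is_derive_eq; rewrite scaler0 expR0 mul1r.
have d2 : is_derive (0 : R) 1 (fun b => cos (l * b)) 0.
  rewrite (_ : (fun _ => _) = cos \o (fun b : R => l *: b))//.
  by apply: is_derive_eq; rewrite scaler0 sin0 oppr0 mul0r.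
have d3 : is_derive (0 : R) 1 (fun b => sin (l * b)) l.
  rewrite (_ : (fun _ => _) = sin \o (fun b : R => l *: b))//.
  by apply: is_derive_eq; rewrite scaler0 cos0 mul1r.
suff K e : 0 < e -> exists2 d : R, 0 < d & forall a b : R, `|a| < d -> `|b| < d ->
    `|expR (- (l * b)) * cos (l * a) - 1 + l * b| <= e * (`|a| + `|b|) /\
    `|expR (- (l * b)) * sin (l * a) - l * a| <= e * (`|a| + `|b|).
  move=> e e0; have [d d0 Hd] := K (e / 4) ltac:(by rewrite divr_gt0).
  exists d => // -[a b] hd; rewrite add0r cexp0.
  have hR : `|a| <= nc (a +i* b) := Re_le_normc (a +i* b).
  have hI : `|b| <= nc (a +i* b) := Im_le_normc (a +i* b).
  rewrite (_ : _ - _ = (expR (- (l * b)) * cos (l * a) - 1 + l * b) +i*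
     (expR (- (l * b)) * sin (l * a) - l * a)); last first.
    by apply/eqP; rewrite eq_complex /=; apply/andP; split; apply/eqP; ring.
  have [k1 k2] := Hd a b (le_lt_trans hR hd) (le_lt_trans hI hd).
  apply: le_trans (normc_le_ReIm _) _.
  have : e / 4 * (`|a| + `|b|) <= e / 4 * (2 * nc (a +i* b)).
    by rewrite ler_pM2l ?divr_gt0//; lra.
  rewrite [complex.Re _]/= [complex.Im _]/=; lra.
move=> e0; set k : R := 3 + `|l|.
have k0 : 0 < k by rewrite /k; have := normr_ge0 l; lra.
have e10 : 0 < Num.min 1 (e / k) by rewrite lt_min ltr01 divr_gt0.
set e1 := Num.min 1 (e / k) in e10.
have [e11 e1e] : e1 <= 1 /\ e1 * k <= e.
  by rewrite -ler_pdivlMr// /e1; split; rewrite ge_min lexx ?orbT.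
clearbody e1.
have [d1' d10 H1] := is_derive_epsdelta d1 e10.
have [d2' d20 H2] := is_derive_epsdelta d2 e10.
have [d3' d30 H3] := is_derive_epsdelta d3 e10.
pose d := Num.min (Num.min d1' d2') (Num.min d3' (e1 / (`|l| + 1))).
have d0 : 0 < d by rewrite !lt_min d10 d20 d30 divr_gt0// ltr_wpDl.
exists d => // a b; rewrite !lt_min => /andP[/andP[a1 a2] /andP[a3 a4]] /andP[/andP[b1 b2] /andP[b3 b4]].
have := H1 b b1; have := H2 a a2; have := H3 a a3.
rewrite !mulr0 oppr0 expR0 cos0 sin0 mul0r !subr0 mulNr opprK => h3 h2 h1.
have c1 : `|cos (l * a)| <= 1 by rewrite ler_norml cos_geN1 cos_le1.
have [A0 B0 L0] : [/\ 0 <= `|a|, 0 <= `|b| & 0 <= `|l|] by [].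
have ea : e1 * `|a| <= `|a| by rewrite ler_piMl.
have eb : e1 * `|b| <= `|b| by rewrite ler_piMl.
have s1 : `|sin (l * a)| <= (`|l| + 1) * `|a|.
  have := ler_normD (sin (l * a) - l * a) (l * a); rewrite subrK normrM; lra.
have bk : `|b| * (`|l| + 1) <= e1 by rewrite -ler_pdivlMr ?ltW// ltr_wpDl.
have a1' : `|a| <= 1.
  have : `|a| * (`|l| + 1) <= e1 by rewrite -ler_pdivlMr ?ltW// ltr_wpDl.
  have := mulr_ge0 A0 L0; lra.
move: (expR _) (cos _) (sin _) h1 h2 h3 c1 s1 => r c s h1 h2 h3 c1 s1.
have r1 : `|r - 1| <= e1.
  have := ler_normD (r - 1 + l * b) (- (l * b)); rewrite addrK normrN normrM; lra.
have ka : e1 * k * `|a| <= e * `|a| by rewrite ler_wpM2r.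
have kb : e1 * k * `|b| <= e * `|b| by rewrite ler_wpM2r.
have [P1 P2] : 0 <= e1 * `|a| /\ 0 <= e1 * `|b| by rewrite !mulr_ge0// ltW.
have [P3 P4] : 0 <= e1 * `|a| * `|l| /\ 0 <= e1 * `|b| * `|l| by split; exact: mulr_ge0.
rewrite /k in ka kb; split.
  have -> : r * c - 1 + l * b = (r - 1 + l * b) * c + (c - 1) - (l * b) * (c - 1) by ring.
  apply: le_trans (ler_normB _ _) _; apply: le_trans (lerD (ler_normD _ _) (lexx _)) _.
  rewrite !normrM.
  have : `|r - 1 + l * b| * `|c| <= e1 * `|b| * 1 by rewrite ler_pM.
  have : `|l| * `|b| * `|c - 1| <= `|b| * (`|l| * e1).
    rewrite [`|l| * _]mulrC -mulrA ler_wpM2l// ler_wpM2l//.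
    by apply: le_trans h2 _; rewrite ler_piMr// ltW// (lt_le_trans a4).
  lra.
have -> : r * s - l * a = (s - l * a) + (r - 1) * s by ring.
apply: le_trans (ler_normD _ _) _; rewrite normrM.
have : `|r - 1| * `|s| <= e1 * ((`|l| + 1) * `|a|) by rewrite ler_pM.
lra.
Qed.

Lemma cexp_cderivable l z : cderivable (cexp l) z.
Proof.
have D0 : cderivable (cexp l) (- z + z).
  by apply/derivableP_normc; exists (0 +i* l); rewrite addNr; exact: cexp_cderiv0.
apply/derivableP_normc; exists (cexp l z * (0 +i* l)) => e e0.
have N0 : 0 < nc (cexp l z) by rewrite normc_cexp expR_gt0.
have [d d0 Hd] := cexp_cderiv0 l (divr_gt0 e0 N0).
exists d => // h /Hd; rewrite add0r cexp0 => K.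
have -> : cexp l (z + h) - cexp l z - cexp l z * (0 +i* l) * h =
    cexp l z * (cexp l h - 1 - (0 +i* l) * h) by rewrite cexpD; ring.
by rewrite Normc.normcM mulrC -ler_pdivlMr// mulrAC.
Qed.

End ComplexExp.

(** * Trigonometric polynomials in the upper half-plane *)

Section TrigPoly.
Variable R : realType.
Notation mu := (@lebesgue_measure R).
Notation C := R[i].
Notation nc := (@Normc.normc R).
Notation Re := complex.Re.
Notation Im := complex.Im.
Notation cderivable F z := (derivable ((F : C -> C) : C^o -> C^o) z 1).
Implicit Types (F G : C -> C) (z w : C) (l x y : R) (s : seq (C * R)).

Definition trig_ext s z : C := \sum_(p <- s) p.1 * cexp p.2 z.

Definition nonneg_freq s := forall p, p \in s -> 0 <= p.2.

Lemma trig_ext_real s x : trig_ext s (x +i* 0) = trig_poly s x.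
Proof. by apply: eq_bigr => p _; rewrite cexp_real. Qed.

Lemma trig_ext_cderivable s z : cderivable (trig_ext s) z.
Proof.
elim: s => [|p s IH].
  rewrite (_ : trig_ext _ = fun=> 0); first exact: cderivable_cst.
  by apply/funext => w; rewrite /trig_ext big_nil.
rewrite (_ : trig_ext _ = fun w => p.1 * cexp p.2 w + trig_ext s w).
  apply: (@cderivableD R (fun w => p.1 * cexp p.2 w) (trig_ext s)); last exact: IH.
  apply: (@cderivableM R (fun=> p.1)); [exact: cderivable_cst|exact: cexp_cderivable].
by apply/funext => w; rewrite /trig_ext big_cons.
Qed.

Lemma trig_ext_bounded s c : nonneg_freq s ->
  exists M, forall z, - c <= Im z -> nc (trig_ext s z) <= M.
Proof.
elim: s => [|p s IH] nn.
  by exists 0 => z _; rewrite /trig_ext big_nil Normc.normc0.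
have [|M HM] := IH; first by move=> q qs; apply: nn; rewrite inE qs orbT.
exists (nc p.1 * expR (p.2 * c) + M) => z zc.
rewrite /trig_ext big_cons; apply: le_trans (le_normcD _ _) _; apply: lerD; last exact: HM.
rewrite Normc.normcM normc_cexp ler_wpM2l ?normc_ge0// ler_expR -mulrN.
by rewrite ler_wpM2l ?nn ?inE ?eqxx// lerNl.
Qed.

(** The formula is applied one unit lower, to [z -> trig_ext s (z - i)], which is
    still bounded in the half-plane; this puts the line at height 0. *)
Lemma trig_ext_poisson s x y : nonneg_freq s -> 0 < y ->
  \int[mu]_t (Re (trig_poly s t) * poisson_kernel x y t) =
  pi * Re (trig_ext s (x +i* y)).
Proof.
move=> nn y0.
have [M HM] := trig_ext_bounded 1 nn.
pose F z := trig_ext s (z + 0 +i* (-1)).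
have aF : analytic_on (@upper_half R) F.
  by move=> z _; apply: cderivable_shift; exact: trig_ext_cderivable.
have bF z : 0 < Im z -> nc (F z) <= M.
  by move=> z0; apply: HM; rewrite cImD /=; lra.
have := @poisson_formula R F M x y 1 aF bF y0 ltr01.
have E a b : F (a +i* (b + 1)) = trig_ext s (a +i* b).
  by congr trig_ext; apply/eqP; rewrite eq_complex /= addr0 addrK !eqxx.
rewrite E => <-; apply: eq_Rintegral => t _.
by rewrite -(add0r 1) E trig_ext_real.
Qed.

Lemma trig_poly_Re_continuous s : continuous (fun t => Re (trig_poly s t)).
Proof.
move=> t; rewrite (_ : (fun _ => _) = fun t => Re (trig_ext s (t +i* 0))).
  by apply: cderivable_horizontal_continuous; exact: trig_ext_cderivable.
by apply/funext => u; rewrite trig_ext_real.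
Qed.

Definition trig_scale (c : C) s := [seq (c * p.1, p.2) | p <- s].

Lemma trig_ext_scale c s z : trig_ext (trig_scale c s) z = c * trig_ext s z.
Proof. by rewrite /trig_ext big_map mulr_sumr; apply: eq_bigr => p _; rewrite mulrA. Qed.

Lemma nonneg_freq_scale c s : nonneg_freq s -> nonneg_freq (trig_scale c s).
Proof. by move=> nn _ /mapP[p ps ->]; exact: (nn p ps). Qed.

Lemma normc_by_Re (K : R) z : Re z <= K -> Re (- z) <= K ->
   Re ((0 +i* (-1)) * z) <= K -> Re (- ((0 +i* (-1)) * z)) <= K -> nc z <= 2 * K.
Proof.
move=> h1 h2 h3 h4; apply: le_trans (normc_le_ReIm _) _.
move: h1 h2 h3 h4; rewrite !cReN cReM /= mul0r mulN1r sub0r opprK => h1 h2 h3 h4.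
have : `|Re z| <= K by rewrite ler_norml; lra.
have : `|Im z| <= K by rewrite ler_norml; lra.
lra.
Qed.

Lemma normc_m1i : nc (0 +i* (-1)) = 1.
Proof. by rewrite /= expr0n add0r sqrrN expr1n sqrtr1. Qed.

Lemma ler_Rintegral_poisson (f : R -> R) (k x y : R) : 0 < y ->
  mu.-integrable setT (EFin \o f) ->
  (forall t, `|f t| <= k * poisson_kernel x y t) ->
  `|\int[mu]_t f t| <= k * pi.
Proof.
move=> y0 fi fk; apply: le_trans (le_normr_Rintegral measurableT fi) _.
rewrite -(Rintegral_poisson_kernel x y0) -RintegralZl//; last exact: integrable_poisson_kernel.
apply: le_Rintegral => //; first exact: (integrable_norm fi).
exact: (integrableZl measurableT k (integrable_poisson_kernel x y0)).
Qed.

Lemma trig_ext_Re_le s (B x y : R) : nonneg_freq s -> 0 < y ->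
  (forall t, nc (trig_poly s t) <= B) -> `|Re (trig_ext s (x +i* y))| <= B.
Proof.
move=> nn y0 sB.
have pi0 := pi_gt0 R.
rewrite -(ler_pM2r pi0) -{1}(gtr0_norm pi0) -normrM mulrC -trig_ext_poisson//.
apply: (@ler_Rintegral_poisson _ _ x y) => //.
  apply: (@integrable_mul_poisson _ _ x y B y0 (@trig_poly_Re_continuous s)) => t.
  by apply: le_trans (Re_le_normc _) _.
move=> t; rewrite normrM (gtr0_norm (poisson_kernel_gt0 x t y0)).
by rewrite ler_pM2r ?poisson_kernel_gt0//; apply: le_trans (Re_le_normc _) _.
Qed.

(** A Poisson integral is an average of boundary values.  The factor 2 comes from
    treating real and imaginary parts separately. *)
Lemma trig_ext_le s (B : R) z : nonneg_freq s -> 0 < Im z ->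
  (forall t, nc (trig_poly s t) <= B) -> nc (trig_ext s z) <= 2 * B.
Proof.
move=> nn z0 sB; case: z z0 => x y /= y0.
have H1 := trig_ext_Re_le x nn y0 sB.
have H2 : `|Re (trig_ext (trig_scale (0 +i* (-1)) s) (x +i* y))| <= B.
  apply: trig_ext_Re_le => //; first exact: nonneg_freq_scale.
  by move=> t; rewrite -trig_ext_real trig_ext_scale Normc.normcM normc_m1i mul1r trig_ext_real.
rewrite trig_ext_scale in H2.
by apply: normc_by_Re; rewrite ?cReN; move: H1 H2; rewrite !ler_norml; lra.
Qed.

(** With D and D' the two denominators, the difference is
    [((y + b) D - y D') / (D D')].  The numerator is at most [5 e D], and
    [D <= 6 D'] because the displacement is at most [y / 2]. *)
Lemma poisson_kernel_lipschitz (x y a b e t : R) : 0 < y ->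
  `|a| <= e -> `|b| <= e -> e <= y / 2 ->
  `|poisson_kernel (x + a) (y + b) t - poisson_kernel x y t| <=
    30 * e / y * poisson_kernel x y t.
Proof.
move=> y0 ae be ey.
have e0 : 0 <= e by apply: le_trans ae.
have yb : y / 2 <= y + b by move: be; rewrite ler_norml; lra.
have yb0 : 0 < y + b by lra.
have D0 := poisson_den_gt0 x t y0.
have D'0 := poisson_den_gt0 (x + a) t yb0.
rewrite /poisson_kernel.
have -> : t - (x + a) = t - x - a by ring.
rewrite (_ : t - (x + a) = t - x - a) in D'0; last by ring.
move: (t - x) D0 D'0 => u; set D := u ^+ 2 + y ^+ 2; set D' := (u - a) ^+ 2 + (y + b) ^+ 2 => D0 D'0.
have yb2 : y ^+ 2 <= 4 * (y + b) ^+ 2.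
  have -> : 4 * (y + b) ^+ 2 = (2 * (y + b)) ^+ 2 by ring.
  by rewrite lerXn2r ?nnegrE; lra.
have a2 : a ^+ 2 <= y ^+ 2 / 4.
  have -> : y ^+ 2 / 4 = (y / 2) ^+ 2 by field.
  by rewrite -(real_normK (num_real a)) lerXn2r ?nnegrE ?normr_ge0//; lra.
have DD' : D <= 6 * D'.
  have := sqr_ge0 (u - 2 * a); have := sqr_ge0 (u - a); rewrite /D /D' => h' h.
  have -> : u ^+ 2 = 2 * (u - a) ^+ 2 + 2 * a ^+ 2 - (u - 2 * a) ^+ 2 by ring.
  lra.
have num : `|(y + b) * D - y * D'| <= 5 * e * D.
  have -> : (y + b) * D - y * D' = b * D + (2 * y * u * a - y * a ^+ 2 - 2 * y ^+ 2 * b - y * b ^+ 2).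
    by rewrite /D /D'; ring.
  have h1 : `|b * D| <= e * D by rewrite normrM (gtr0_norm D0) ler_pM2r.
  have h2 : `|u| * (2 * y) <= D.
    have := sqr_ge0 (`|u| - y); rewrite /D -(real_normK (num_real u)) => h.
    have -> : `|u| * (2 * y) = `|u| ^+ 2 + y ^+ 2 - (`|u| - y) ^+ 2 by ring.
    lra.
  have h3 : `|2 * y * u * a| <= e * D.
    rewrite !normrM ger0_norm// (gtr0_norm y0).
    have -> : 2 * y * `|u| * `|a| = `|a| * (`|u| * (2 * y)) by ring.
    by rewrite ler_pM// !mulr_ge0// ltW.
  have yD : y ^+ 2 <= D by rewrite /D lerDr sqr_ge0.
  have sq c : `|c| <= e -> `|y * c ^+ 2| <= e * D / 2.
    move=> ce; rewrite normrM (gtr0_norm y0) normrX.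
    have : `|c| ^+ 2 <= e * (y / 2) by rewrite expr2 ler_pM//; lra.
    rewrite -(ler_pM2l y0) => h; apply: le_trans h _.
    have -> : y * (e * (y / 2)) = e * y ^+ 2 / 2 by ring.
    by rewrite ler_pM2r// ler_wpM2l.
  have h4 := sq a ae; have h5 := sq b be.
  have h6 : `|2 * y ^+ 2 * b| <= 2 * (e * D).
    rewrite -mulrA normrM ger0_norm// ler_pM2l// normrM ger0_norm ?sqr_ge0//.
    by rewrite mulrC ler_pM// sqr_ge0.
  move: h1 h3 h4 h5 h6; rewrite !ler_norml; lra.
have -> : (y + b) / D' - y / D = ((y + b) * D - y * D') / (D * D').
  by field; rewrite !gt_eqF.
rewrite normrM normfV (gtr0_norm (mulr_gt0 D0 D'0)).
rewrite ler_pdivrMr ?mulr_gt0//.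
have -> : 30 * e / y * (y / D) * (D * D') = 5 * e * (6 * D').
  by field; rewrite !gt_eqF.
by apply: le_trans num _; rewrite ler_wpM2l// mulr_ge0.
Qed.

Lemma trig_ext_Re_lipschitz s (B : R) z h : nonneg_freq s -> 0 < Im z ->
  (forall t, nc (trig_poly s t) <= B) -> nc h <= Im z / 2 ->
  `|Re (trig_ext s (z + h)) - Re (trig_ext s z)| <= 30 * nc h / Im z * B.
Proof.
case: z => x y; case: h => a b nn y0 sB hy.
rewrite [complex.Im _]/= in y0 hy *.
rewrite -[(x +i* y) + _]/((x + a) +i* (y + b)).
set e := nc (a +i* b) in hy *.
have ae : `|a| <= e := Re_le_normc (a +i* b).
have be : `|b| <= e := Im_le_normc (a +i* b).
have yb0 : 0 < y + b by move: be; rewrite ler_norml; lra.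
have pi0 := pi_gt0 R.
have int x1 y1 : 0 < y1 -> mu.-integrable setT
    (EFin \o (fun t => Re (trig_poly s t) * poisson_kernel x1 y1 t)).
  move=> y10; apply: (@integrable_mul_poisson _ _ x1 y1 B y10 (@trig_poly_Re_continuous s)) => t.
  by apply: le_trans (Re_le_normc _) _.
have i1 := int (x + a) (y + b) yb0; have i2 := int x y y0.
rewrite -(ler_pM2r pi0) -{1}(gtr0_norm pi0) -normrM mulrC mulrBr.
rewrite -trig_ext_poisson// -trig_ext_poisson// -RintegralB//.
apply: (@ler_Rintegral_poisson _ _ x y) => //.
  exact: (integrableB measurableT i1 i2).
move=> t; rewrite -mulrBr normrM mulrC -[leRHS]mulrA [B * _]mulrC mulrA.
have lip := poisson_kernel_lipschitz x t y0 ae be hy.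
by apply: ler_pM => //; apply: le_trans (Re_le_normc _) _.
Qed.

(** This plays the part of Cauchy's estimate for the derivative: the bound depends
    on the polynomial only through its supremum on the line. *)
Lemma trig_ext_lipschitz s (B : R) z h : nonneg_freq s -> 0 < Im z ->
  (forall t, nc (trig_poly s t) <= B) -> nc h <= Im z / 2 ->
  nc (trig_ext s (z + h) - trig_ext s z) <= 60 * nc h / Im z * B.
Proof.
move=> nn z0 sB hz.
have H1 := trig_ext_Re_lipschitz nn z0 sB hz.
have := @trig_ext_Re_lipschitz (trig_scale (0 +i* (-1)) s) B z h
  (@nonneg_freq_scale (0 +i* (-1)) s nn) z0 _ hz.
rewrite !trig_ext_scale => /(_ _)-H2.
have {}H2 := H2 ltac:(by move=> t; rewrite -trig_ext_real trig_ext_scale Normc.normcM normc_m1i mul1r trig_ext_real).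
have -> : 60 * nc h / Im z * B = 2 * (30 * nc h / Im z * B) by ring.
by apply: normc_by_Re; rewrite ?mulrBr ?cReN ?cReB; move: H1 H2; rewrite !ler_norml; lra.
Qed.


(** The segments [[u_n - e_n, u_n + e_n]] meet pairwise, so they have a common
    point.  Compared with completeness, this keeps the rate. *)
Lemma sandwich_limit (u e : nat -> R) : (forall n m, u n - u m <= e n + e m) ->
  exists w : R, forall n, `|w - u n| <= e n.
Proof.
move=> H; exists (sup (range (fun n => u n - e n))) => n.
have ub m : u m - e m <= u n + e n by have := H m n; lra.
rewrite ler_norml; apply/andP; split.
  rewrite lerBrDr addrC; apply: ub_le_sup; last by exists n.
  by exists (u n + e n) => _ [m _ <-].
rewrite lerBlDr addrC; apply: ge_sup; first by exists (u n - e n), n.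
by move=> _ [m _ <-].
Qed.

Lemma normc_sandwich_limit (u : nat -> C) (e : nat -> R) :
  (forall n m, nc (u n - u m) <= e n + e m) ->
  exists w : C, forall n, nc (w - u n) <= 2 * e n.
Proof.
move=> H.
have [|a Ha] := @sandwich_limit (fun n => Re (u n)) e.
  by move=> n m; rewrite -cReB; apply: le_trans (ler_norm _) (le_trans (Re_le_normc _) (H n m)).
have [|b Hb] := @sandwich_limit (fun n => Im (u n)) e.
  by move=> n m; rewrite -cImB; apply: le_trans (ler_norm _) (le_trans (Im_le_normc _) (H n m)).
exists (a +i* b) => n; apply: le_trans (normc_le_ReIm _) _.
rewrite cReB cImB [complex.Re (a +i* b)]/= [complex.Im (a +i* b)]/=.
have := Ha n; have := Hb n; lra.
Qed.

Lemma trig_extB s s' z : trig_ext (s ++ trig_scale (-1) s') z = trig_ext s z - trig_ext s' z.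
Proof. by rewrite {1}/trig_ext big_cat /= -!/(trig_ext _ _) trig_ext_scale mulN1r. Qed.

(** The extensions of the approximating polynomials are uniformly Cauchy in the
    half-plane by [trig_ext_le], and so are their difference quotients by
    [trig_ext_lipschitz].  Uniformity lets the limit of the sequence be exchanged
    with the limit in the quotient and with the limit at the boundary. *)
Theorem nonneg_approx_Hinf_plus (f : R -> C) :
  (forall e : R, 0 < e -> exists2 s, nonneg_freq s & forall t, nc (f t - trig_poly s t) <= e) ->
  Hinf_plus f.
Proof.
move=> H.
pose d (n : nat) : R := n.+1%:R^-1.
have d0 n : 0 < d n by rewrite invr_gt0.
have Hex n : exists s, nonneg_freq s /\ forall t, nc (f t - trig_poly s t) <= d n.
  by have [s h1 h2] := H _ (d0 n); exists s.
have [s Hs] := choice Hex.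
pose Q n := trig_ext (s n).
pose df n m := s n ++ trig_scale (-1) (s m).
have nn n m : nonneg_freq (df n m).
  move=> p; rewrite mem_cat => /orP[]; first exact: (Hs n).1.
  by have := @nonneg_freq_scale (-1) _ (Hs m).1; apply.
have dfB n m t : nc (trig_poly (df n m) t) <= d n + d m.
  rewrite -trig_ext_real trig_extB !trig_ext_real.
  have := (Hs n).2 t; have := (Hs m).2 t.
  have := normcB (f t - trig_poly (s m) t) (f t - trig_poly (s n) t).
  rewrite [X in nc X <= _ -> _](_ : _ = trig_poly (s n) t - trig_poly (s m) t); last by ring.
  by lra.
have Qc n m z : 0 < Im z -> nc (Q n z - Q m z) <= 2 * d n + 2 * d m.
  by move=> z0; rewrite -mulrDr -trig_extB; exact: (trig_ext_le (nn n m) z0 (dfB n m)).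
have Fex z : exists w, 0 < Im z -> forall n, nc (w - Q n z) <= 4 * d n.
  have [z0|z0] := boolP (0 < Im z); last by exists 0.
  have [w Hw] := normc_sandwich_limit (fun n m => Qc n m z z0).
  by exists w => _ n; have := Hw n; lra.
have [F HF] := choice Fex.
have small e : 0 < e -> exists n, d n <= e.
  move=> e0; exists (Num.trunc e^-1); rewrite /d invf_ple ?posrE ?ltr0n//.
  exact/ltW/truncnS_gt.
(* The limit, as m grows, of the Lipschitz bound for [Q m - Q n]. *)
have diff z h n : 0 < Im z -> nc h <= Im z / 2 ->
    nc ((F (z + h) - F z) - (Q n (z + h) - Q n z)) <= 60 * nc h / Im z * d n.
  move=> z0 hz.
  have zh : 0 < Im (z + h).
    by have := Im_le_normc h; rewrite cImD ler_norml; lra.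
  apply/ler_addgt0Pr => e e0.
  have k0 : 0 <= 60 * nc h / Im z by rewrite divr_ge0 ?mulr_ge0 ?normc_ge0// ltW.
  have [m Hm] := small (e / (60 * nc h / Im z + 8)) ltac:(by rewrite divr_gt0// ltr_wpDl).
  rewrite ler_pdivlMr ?ltr_wpDl// in Hm.
  have h1 := HF _ z0 m; have h2 := HF _ zh m.
  have := trig_ext_lipschitz (nn m n) z0 (dfB m n) hz.
  rewrite !trig_extB -/(Q m) -/(Q n) => h3.
  have -> : F (z + h) - F z - (Q n (z + h) - Q n z) =
    (F (z + h) - Q m (z + h)) - (F z - Q m z) + (Q m (z + h) - Q n (z + h) - (Q m z - Q n z)) by ring.
  apply: le_trans (le_normcD _ _) _; have := normcB (F (z + h) - Q m (z + h)) (F z - Q m z).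
  by move: Hm h3; rewrite !mulrDr; lra.
exists F; split.
- move=> z; rewrite /upper_half /= => z0; apply/derivableP_normc.
  have dQ n := (derivableP_normc (Q n) z).1 (@trig_ext_cderivable (s n) z).
  have [L HL] := choice dQ.
  pose k := 60 / Im z.
  have k0 : 0 < k by rewrite divr_gt0.
  have Lc n m : nc (L n - L m) <= k * d n + k * d m.
    apply/ler_addgt0Pr => e e0; have e20 : 0 < e / 2 by rewrite divr_gt0.
    have [d1 d10 H1] := HL n _ e20; have [d2 d20 H2] := HL m _ e20.
    pose t := Num.min (Num.min (d1 / 2) (d2 / 2)) (Im z / 2).
    have t0 : 0 < t by rewrite !lt_min !divr_gt0.
    have : t <= t by [].
    rewrite {2}/t !le_min => /andP[/andP[t1 t2] t3].
    have nt : nc t%:C = t by rewrite normc_real gtr0_norm.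
    have h1 := H1 t%:C ltac:(rewrite nt; lra); have h2 := H2 t%:C ltac:(rewrite nt; lra).
    have h3 := trig_ext_lipschitz (nn n m) z0 (dfB n m) (h := t%:C) ltac:(by rewrite nt).
    rewrite !trig_extB -/(Q m) -/(Q n) nt in h3; rewrite nt in h1 h2.
    rewrite -(ler_pM2r t0) -[X in nc _ * X]nt -Normc.normcM.
    have -> : (L n - L m) * t%:C = (Q n (z + t%:C) - Q m (z + t%:C) - (Q n z - Q m z))
       - (Q n (z + t%:C) - Q n z - L n * t%:C) + (Q m (z + t%:C) - Q m z - L m * t%:C) by ring.
    apply: le_trans (le_normcD _ _) _.
    have := normcB (Q n (z + t%:C) - Q m (z + t%:C) - (Q n z - Q m z)) (Q n (z + t%:C) - Q n z - L n * t%:C).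
    have : 60 * t / Im z * (d n + d m) = k * d n * t + k * d m * t by rewrite /k; ring.
    by rewrite !mulrDl; clear -h1 h2 h3; lra.
  have [L0 HL0] := normc_sandwich_limit Lc.
  exists L0 => e e0.
  have k60 : 0 < 6 * k by apply: mulr_gt0.
  have [n Hn] := small (e / (6 * k)) ltac:(by rewrite divr_gt0).
  rewrite ler_pdivlMr// in Hn.
  have [d1 d10 H1] := HL n (e / 2) ltac:(by rewrite divr_gt0).
  exists (Num.min d1 (Im z / 2)); first by rewrite lt_min d10 divr_gt0.
  move=> h; rewrite lt_min => /andP[hd hz].
  have h1 := H1 h hd; have h2 := diff z h n z0 (ltW hz).
  have h3 : nc ((L0 - L n) * h) <= 2 * (k * d n) * nc h.
    by rewrite Normc.normcM ler_wpM2r ?normc_ge0.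
  have h4 : d n * (6 * k) * nc h <= e * nc h by rewrite ler_wpM2r ?normc_ge0.
  have h5 : 60 * nc h / Im z * d n = k * d n * nc h by rewrite /k; ring.
  have -> : F (z + h) - F z - L0 * h = (F (z + h) - F z - (Q n (z + h) - Q n z))
     + (Q n (z + h) - Q n z - L n * h) - (L0 - L n) * h by ring.
  apply: le_trans (normcB _ _) _.
  have := le_normcD (F (z + h) - F z - (Q n (z + h) - Q n z)) (Q n (z + h) - Q n z - L n * h).
  by rewrite h5 in h2; lra.
- apply: (bounded_fun_onP _ _).2.
  have [M HM] := trig_ext_bounded 0 (Hs 0%N).1.
  exists (4 * d 0%N + M) => z z0; rewrite -(subrK (Q 0%N z) (F z)).
  apply: le_trans (le_normcD _ _) _; apply: lerD; first exact: HF.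
  by apply: HM; rewrite oppr0 ltW.
- apply: aeW => x; apply: (nontangential_limitP _ _ _ _).2 => a a0 e e0.
  have [n Hn] := small (e / 6) ltac:(by rewrite divr_gt0).
  have [r r0 Hr] := cderivable_normc_continuous (@trig_ext_cderivable (s n) (x +i* 0))
    (e := e / 6) ltac:(by rewrite divr_gt0).
  exists r => // z z0 _ zr.
  have h1 := HF z z0 n; have h2 := (Hs n).2 x.
  have E : (x +i* 0) + (z - x%:C) = z by rewrite addrC; exact: subrK.
  have := Hr (z - x%:C) zr; rewrite E -/(Q n) => h3.
  rewrite -trig_ext_real -/(Q n) in h2.
  have -> : f x - F z = (f x - Q n (x +i* 0)) - (Q n z - Q n (x +i* 0)) - (F z - Q n z) by ring.
  apply: le_trans (normcB _ _) _.
  have := normcB (f x - Q n (x +i* 0)) (Q n z - Q n (x +i* 0)).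
  by lra.
Qed.

End TrigPoly.

(** * Folner sets of real frequencies *)

Section Folner.
Variable R : realType.
Implicit Types (l A : seq R) (d : R).

Lemma bernoulli_le d k : 0 <= d -> 1 + k%:R * d <= (1 + d) ^+ k.
Proof.
move=> d0; elim: k => [|k IH]; first by rewrite mul0r addr0 expr0.
rewrite exprS; apply: (@le_trans _ _ ((1 + d) * (1 + k%:R * d))).
  rewrite -natr1; have : 0 <= d * (k%:R * d) by rewrite !mulr_ge0.
  lra.
by rewrite ler_wpM2l//; lra.
Qed.

Lemma exp_beats_poly d m : 0 < d -> exists N, (N.+1 ^ m)%:R < (1 + d) ^+ N.
Proof.
move=> d0.
(* With [N = k (m + 1)], the left side is at most [(k (m + 2))^m], and the right
   side is at least [(k d)^(m + 1)] by Bernoulli's inequality. *)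
pose c : R := (m.+2 ^ m)%:R / d ^+ m.+1.
have c0 : 0 <= c by rewrite divr_ge0// exprn_ge0// ltW.
pose k := (Num.trunc c).+1.
have kc : c < k%:R by exact: truncnS_gt.
have k0 : (0 < k)%N by [].
exists (k * m.+1)%N.
apply: (@le_lt_trans _ _ ((k%:R * m.+2%:R) ^+ m)).
  rewrite -natrM -natrX ler_nat.
  have [m0|m0] := posnP m; first by rewrite m0 !expn0.
  rewrite leq_exp2r//.
  by rewrite [X in (_ <= X)%N]mulnS -add1n leq_add2r.
apply: (@lt_le_trans _ _ ((k%:R * d) ^+ m.+1)).
  rewrite exprMn [ltRHS]exprMn [k%:R ^+ m.+1]exprSr -mulrA.
  rewrite ltr_pM2l ?exprn_gt0 ?ltr0n// -natrX.
  by rewrite -ltr_pdivrMr// exprn_gt0.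
rewrite exprM lerXn2r ?nnegrE//.
- by rewrite mulr_ge0// ltW.
- by rewrite exprn_ge0//; lra.
by apply: le_trans (bernoulli_le k (ltW d0)); rewrite lerDr.
Qed.

(** The sums of elements of l with multiplicities at most N.  As the image of a
    box of integer vectors, this set has at most [(N + 1) ^ size l] elements. *)
Definition box l N : seq R :=
  undup (codom (fun f : {ffun 'I_(size l) -> 'I_N.+1} => \sum_(i < size l) l`_i *+ f i)).

Lemma boxP l N x : reflect
  (exists2 g : 'I_(size l) -> nat, forall i, (g i <= N)%N & x = \sum_(i < size l) l`_i *+ g i)
  (x \in box l N).
Proof.
rewrite mem_undup; apply: (iffP codomP) => [[f ->]|[g gN ->]].
  by exists (fun i => nat_of_ord (f i)) => // i; rewrite -ltnS.
exists [ffun i => inord (g i)]; apply: eq_bigr => i _.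
by rewrite ffunE inordK// ltnS.
Qed.

Lemma size_box l N : (size (box l N) <= N.+1 ^ size l)%N.
Proof.
apply: leq_trans (size_undup _) _.
by rewrite size_codom card_ffun !card_ord.
Qed.

Lemma box_sub l N : {subset box l N <= box l N.+1}.
Proof.
by move=> x /boxP[g gN ->]; apply/boxP; exists g => // i; exact: leqW.
Qed.

Lemma box_shift l N x a : a \in l -> x \in box l N -> x + a \in box l N.+1.
Proof.
move=> /(nthP 0)[j jl <-] /boxP[g gN ->]; apply/boxP.
exists (fun i => g i + (i == Ordinal jl))%N.
  by move=> i; rewrite -addn1 leq_add// leq_b1.
under [RHS]eq_bigr do rewrite mulrnDr.
rewrite big_split /=; congr (_ + _).
rewrite (bigD1 (Ordinal jl))//= eqxx big1 ?addr0// => i /negbTE ->.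
by rewrite mulr0n.
Qed.

Lemma box_gt0 l N : (0 < size (box l N))%N.
Proof.
rewrite lt0n size_eq0; apply/negP => /eqP e.
have : 0 \in box l N.
  by apply/boxP; exists (fun=> 0%N) => //; rewrite big1// => i _; rewrite mulr0n.
by rewrite e.
Qed.

(** Otherwise the size of [box l N] would grow exponentially in N. *)
Lemma box_slow_growth l d : 0 < d ->
  exists N, (size (box l N.+1))%:R <= (1 + d) * (size (box l N))%:R.
Proof.
move=> d0; apply/not_existsP => H.
have {}H N : (1 + d) * (size (box l N))%:R < (size (box l N.+1))%:R.
  by rewrite ltNge; exact/negP/H.
have G N : (1 + d) ^+ N <= (size (box l N))%:R.
  elim: N => [|N IH]; first by rewrite expr0 ler1n box_gt0.
  rewrite exprS; apply: le_trans (ltW (H N)); rewrite ler_wpM2l//; lra.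
have [N HN] := exp_beats_poly (size l) d0.
have := lt_le_trans HN (G N); rewrite ltr_nat ltnNge size_box//.
Qed.

(** Translation by an element of l sends [box l N] into [box l N.+1].  When the
    latter is hardly larger than the former, most of [box l N] stays in itself.
    Counting sums in R rather than integer vectors takes care of the rational
    dependencies between the elements of l. *)
Lemma folner l d : 0 < d -> exists A, [/\ uniq A, (0 < size A)%N &
  forall a, a \in l -> (1 - d) * (size A)%:R <= (count (fun b => b + a \in A) A)%:R].
Proof.
move=> d0; have [N HN] := box_slow_growth l d0.
exists (box l N); split; [exact: undup_uniq|exact: box_gt0|move=> a al].
set A := box l N; set B := box l N.+1 in HN.
suff H : (size A <= count (fun b => (b + a)%R \in A) A + (size B - size A))%N.
  have AB : (size A <= size B)%N.
    by apply: uniq_leq_size; [exact: undup_uniq|exact: box_sub].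
  move: H; rewrite -(ler_nat R) natrD natrB// -/A in HN * => H.
  by rewrite -/A in HN; lra.
rewrite -{1}(count_predC (fun b => (b + a)%R \in A) A) leq_add2l.
have AB : (size B - size A)%N = size [seq b <- B | b \notin A].
  have -> : size A = size [seq b <- B | b \in A].
    apply/perm_size/uniq_perm; [exact: undup_uniq|exact/filter_uniq/undup_uniq|].
    move=> x; rewrite mem_filter; apply/idP/andP => [xA|[]//].
    by split=> //; exact: box_sub.
  rewrite !size_filter -(count_predC (fun b => b \in A) B) addKn.
  by apply: eq_count.
rewrite AB -size_filter -(size_map (fun b => b + a)).
apply: uniq_leq_size.
  rewrite map_inj_uniq; first exact/filter_uniq/undup_uniq.
  exact: addIr.
move=> _ /mapP[b + ->]; rewrite !mem_filter /= => /andP[-> bA] /=.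
exact: box_shift.
Qed.

End Folner.

(** * Mean values on the line *)

Section Mean.
Variable R : realType.
Notation mu := (@lebesgue_measure R).
Notation C := R[i].
Notation nc := (@Normc.normc R).
Notation Re := complex.Re.
Notation Im := complex.Im.
Implicit Types (f g : R -> C) (m c : C) (s : seq (C * R)) (l T x : R).

Definition ccont f := continuous (fun x => Re (f x)) /\ continuous (fun x => Im (f x)).

Definition avg T f : C := ((2 * T)^-1)%:C * cintegral `[- T, T] f.

(** Existence and value of the mean, together with the continuity that makes
    integrals over segments additive. *)
Definition is_mean f m := ccont f /\
  forall e, 0 < e -> exists2 T0, 0 < T0 & forall T, T0 <= T -> nc (m - avg T f) <= e.

Lemma cont_seg (h : R -> R) a b : continuous h -> cont_on h a b.
Proof. by move=> ch x _; exact: ch. Qed.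

Lemma ccontD f g : ccont f -> ccont g -> ccont (fun x => f x + g x).
Proof.
move=> [f1 f2] [g1 g2]; split => x.
  by under eq_fun do rewrite cReD; apply: cvgD; [exact: f1|exact: g1].
by under eq_fun do rewrite cImD; apply: cvgD; [exact: f2|exact: g2].
Qed.

Lemma ccontM f g : ccont f -> ccont g -> ccont (fun x => f x * g x).
Proof.
move=> [f1 f2] [g1 g2]; split => x.
  under eq_fun do rewrite cReM.
  by apply: cvgB; apply: cvgM; [exact: f1|exact: g1|exact: f2|exact: g2].
under eq_fun do rewrite cImM.
by apply: cvgD; apply: cvgM; [exact: f1|exact: g2|exact: f2|exact: g1].
Qed.

Lemma ccont_cst c : ccont (fun=> c).
Proof. by split => x; exact: cst_continuous. Qed.

Lemma ccont_e l : ccont (e_ l).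
Proof.
have cl : continuous (fun x : R => l * x).
  by move=> x; apply: cvgM; [exact: cvg_cst|exact: cvg_id].
split => x.
  by apply: (@continuous_comp _ _ _ (fun x => l * x) cos); [exact: cl|exact: continuous_cos].
by apply: (@continuous_comp _ _ _ (fun x => l * x) sin); [exact: cl|exact: continuous_sin].
Qed.

Lemma avgD T f g : ccont f -> ccont g -> avg T (fun x => f x + g x) = avg T f + avg T g.
Proof.
move=> [f1 f2] [g1 g2]; rewrite /avg -mulrDr; congr (_ * _).
have ER : (fun x => Re (f x + g x)) = (fun x => Re (f x) + Re (g x)).
  by apply/funext => x; rewrite cReD.
have EI : (fun x => Im (f x + g x)) = (fun x => Im (f x) + Im (g x)).
  by apply/funext => x; rewrite cImD.
rewrite /cintegral ER EI !RintegralD//; by apply: cont_on_integrable; exact: cont_seg.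
Qed.

Lemma avgZ T c f : ccont f -> avg T (fun x => c * f x) = c * avg T f.
Proof.
move=> [f1 f2]; rewrite /avg mulrCA; congr (_ * _).
have i1 := cont_on_integrable (@cont_seg _ (- T) T f1).
have i2 := cont_on_integrable (@cont_seg _ (- T) T f2).
have iZ (k : R) (h : R -> R) : continuous h ->
    mu.-integrable `[- T, T] (EFin \o (fun x => k * h x)).
  move=> ch; apply/cont_on_integrable/cont_seg => x.
  by apply: cvgM; [exact: cvg_cst|exact: ch].
have ER : (fun x => Re (c * f x)) = (fun x => Re c * Re (f x) - Im c * Im (f x)).
  by apply/funext => x; rewrite cReM.
have EI : (fun x => Im (c * f x)) = (fun x => Re c * Im (f x) + Im c * Re (f x)).
  by apply/funext => x; rewrite cImM.
rewrite /cintegral ER EI RintegralB// ?RintegralD//; try exact: iZ.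
rewrite !RintegralZl//.
by apply/eqP; rewrite eq_complex cReM cImM !eqxx.
Qed.

Lemma avg_le T f (k : R -> R) : 0 < T -> ccont f -> continuous k ->
  (forall x, nc (f x) <= k x) -> nc (avg T f) <= 2 * Re (avg T (fun x => (k x)%:C)).
Proof.
move=> T0 [f1 f2] ck fk.
have ik := cont_on_integrable (@cont_seg _ (- T) T ck).
have part (h : R -> R) : continuous h -> (forall x, `|h x| <= k x) ->
   `|\int[mu]_(x in `[- T, T]) h x| <= \int[mu]_(x in `[- T, T]) k x.
  move=> ch hk; have ih := cont_on_integrable (@cont_seg _ (- T) T ch).
  apply: le_trans (le_normr_Rintegral _ ih) _ => //.
  by apply: le_Rintegral => //; exact: (integrable_norm ih).
have t0 : 0 < (2 * T)^-1 by rewrite invr_gt0 mulr_gt0.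
rewrite /avg Normc.normcM normc_real (gtr0_norm t0) cReM.
rewrite [complex.Re (_%:C)]/= [complex.Im (_%:C)]/= mul0r subr0 mulrCA.
rewrite ler_pM2l//; apply: le_trans (normc_le_ReIm _) _.
have p1 := part _ f1 (fun x => le_trans (Re_le_normc _) (fk x)).
have p2 := part _ f2 (fun x => le_trans (Im_le_normc _) (fk x)).
have -> : Re (cintegral `[- T, T] (fun x => (k x)%:C)) = \int[mu]_(x in `[- T, T]) k x by [].
by rewrite mulr_natl mulr2n; exact: lerD.
Qed.

Lemma is_meanD f g m m' : is_mean f m -> is_mean g m' ->
  is_mean (fun x => f x + g x) (m + m').
Proof.
move=> [cf Hf] [cg Hg]; split; first exact: ccontD.
move=> e e0; have e2 : 0 < e / 2 by rewrite divr_gt0.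
have [T1 T10 H1] := Hf _ e2; have [T2 T20 H2] := Hg _ e2.
exists (Num.max T1 T2); first by rewrite lt_max T10.
move=> T; rewrite ge_max => /andP[/H1 h1 /H2 h2].
rewrite avgD// [X in nc X](_ : _ = (m - avg T f) + (m' - avg T g)); last by ring.
by apply: le_trans (le_normcD _ _) _; lra.
Qed.

Lemma is_meanZ c f m : is_mean f m -> is_mean (fun x => c * f x) (c * m).
Proof.
move=> [cf Hf]; split; first exact: (ccontM (ccont_cst c) cf).
move=> e e0; have c0 : 0 < nc c + 1 by rewrite ltr_wpDl ?normc_ge0.
have [T1 T10 H1] := Hf (e / (nc c + 1)) ltac:(by rewrite divr_gt0).
exists T1 => // T /H1 h1; rewrite avgZ// -mulrBr Normc.normcM.
apply: (@le_trans _ _ (nc c * (e / (nc c + 1)))); first by rewrite ler_wpM2l ?normc_ge0.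
rewrite mulrA ler_pdivrMr// mulrC ler_pM2l//; lra.
Qed.

Lemma avg_cst T c : 0 < T -> avg T (fun=> c) = c.
Proof.
move=> T0; have TT : - T <= T by lra.
rewrite /avg /cintegral !Rintegral_seg_cst//.
apply/eqP; rewrite eq_complex cReM cImM /= !mul0r subr0 addr0.
by apply/andP; split; apply/eqP; field; lra.
Qed.

Lemma is_mean_cst c : is_mean (fun=> c) c.
Proof.
split; first exact: ccont_cst.
move=> e e0; exists 1 => // T T1; rewrite avg_cst; last by lra.
by rewrite subrr Normc.normc0 ltW.
Qed.

Lemma is_mean_ext f g m : f =1 g -> is_mean f m -> is_mean g m.
Proof. by move=> /funext ->. Qed.

Lemma is_mean_sum (I : Type) (r : seq I) (F : I -> R -> C) (M : I -> C) :
  (forall i, is_mean (F i) (M i)) ->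
  is_mean (fun x => \sum_(i <- r) F i x) (\sum_(i <- r) M i).
Proof.
move=> H; elim: r => [|i r IH].
  by rewrite big_nil; apply: is_mean_ext (is_mean_cst 0) => x; rewrite big_nil.
rewrite big_cons; apply: is_mean_ext (is_meanD (H i) IH) => x.
by rewrite big_cons.
Qed.

(** The factor 2 comes from treating real and imaginary parts separately. *)
Lemma is_mean_le f m (k : R -> R) (K : C) (e : R) : is_mean f m ->
  is_mean (fun x => (k x)%:C) K -> (forall x, nc (f x) <= e * k x) ->
  nc m <= 2 * e * Re K.
Proof.
move=> [cf Hf] Hk fk.
have [cek Hek] := is_meanZ e%:C Hk.
have ck : continuous (fun x => e * k x).
  move: cek.1; rewrite (_ : (fun _ => _) = (fun x => e * k x))//.
  by apply/funext => x; rewrite -rmorphM.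
apply/ler_addgt0Pr => d d0.
have d3 : 0 < d / 3 by rewrite divr_gt0.
have [T1 T10 H1] := Hf _ d3; have [T2 T20 H2] := Hek _ d3.
pose T := Num.max T1 T2.
have T0 : 0 < T by rewrite lt_max T10.
have h1 := H1 T ltac:(by rewrite le_max lexx); have h2 := H2 T ltac:(by rewrite le_max lexx orbT).
have h3 := avg_le T0 cf ck fk.
have E : avg T (fun x => e%:C * (k x)%:C) = avg T (fun x => (e * k x)%:C).
  by congr avg; apply/funext => x; rewrite -rmorphM.
have ReE : Re (e%:C * K) = e * Re K by rewrite cReM /= mul0r subr0.
rewrite E in h2; have h4 := le_trans (Re_le_normc _) h2.
rewrite cReB ReE in h4.
have := le_normcD (m - avg T f) (avg T f); rewrite subrK.
by move: h4; rewrite ler_norml; lra.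
Qed.

Lemma is_mean_value f m : is_mean f m -> mean_value f = m.
Proof.
move=> [_ H]; rewrite /mean_value; apply: (@cvg_lim C^o); first exact: norm_hausdorff.
apply/cvgC_normc => e e0; have [T0 T00 HT] := H e e0.
near=> T; apply: HT; near: T; apply: nbhs_pinfty_ge; exact: num_real.
Unshelve. all: by end_near. Qed.

Lemma avg_trig_bound (h H : R -> R) (B T : R) : 0 < T -> continuous h ->
  (forall x, is_derive x (1 : R) H (h x)) -> (forall x, `|H x| <= B) ->
  `|\int[mu]_(x in `[- T, T]) h x| <= 2 * B.
Proof.
move=> T0 ch dH HB.
have cH : continuous H.
  by move=> x; apply: differentiable_continuous; apply/derivable1_diffP; exact: ex_derive.
have -> : \int[mu]_(x in `[- T, T]) h x = H T - H (- T).
  rewrite /Rintegral (@continuous_FTC2 _ h H)//; first lra.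
  - exact: continuous_subspaceT.
  - split.
    + by move=> x _; exact: ex_derive.
    + by apply: cvg_at_right_filter; exact: cH.
    + by apply: cvg_at_left_filter; exact: cH.
  - by move=> x _; rewrite derive1E derive_val.
by apply: le_trans (ler_normB _ _) _; have := HB T; have := HB (- T); lra.
Qed.

(** For [l != 0], the integrals of [cos (l x)] and [sin (l x)] over [[- T, T]]
    stay bounded while they are divided by [2 T]. *)
Lemma is_mean_e l : is_mean (e_ l) (l == 0)%:R.
Proof.
have [->|l0] := eqVneq l 0.
  apply: is_mean_ext (is_mean_cst 1) => x.
  by rewrite /e_ mul0r cos0 sin0.
split; first exact: ccont_e.
move=> e e0.
have ll : 0 < `|l| by rewrite normr_gt0.
exists (2 / `|l| / e); first by rewrite !divr_gt0.
move=> T hT; have T0 : 0 < T by apply: lt_le_trans hT; rewrite !divr_gt0.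
have [c1 c2] := ccont_e l.
have dc x : is_derive x (1 : R) (fun x => l^-1 *: (sin \o (fun x : R => l *: x)) x) (cos (l * x)).
  apply: is_derive_eq; rewrite /GRing.scale /= mulr1.
  by field.
have ds x : is_derive x (1 : R) (fun x => (- l^-1) *: (cos \o (fun x : R => l *: x)) x) (sin (l * x)).
  apply: is_derive_eq; rewrite /GRing.scale /= mulr1.
  by field.
have b1 : `|\int[mu]_(x in `[- T, T]) cos (l * x)| <= 2 * `|l|^-1.
  apply: (avg_trig_bound T0 c1 dc) => x.
  by rewrite /GRing.scale /= normrM normfV ler_piMr ?invr_ge0// ler_norml sin_geN1 sin_le1.
have b2 : `|\int[mu]_(x in `[- T, T]) sin (l * x)| <= 2 * `|l|^-1.
  apply: (avg_trig_bound T0 c2 ds) => x.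
  by rewrite /GRing.scale /= normrM normrN normfV ler_piMr ?invr_ge0// ler_norml cos_geN1 cos_le1.
rewrite sub0r normcN /avg Normc.normcM normc_real gtr0_norm ?invr_gt0 ?mulr_gt0//.
rewrite ler_pdivrMl ?mulr_gt0//.
apply: le_trans (normc_le_ReIm _) _.
rewrite /cintegral /e_ [complex.Re _]/= [complex.Im _]/=.
apply: le_trans (lerD b1 b2) _.
move: hT; rewrite ler_pdivrMr//; lra.
Qed.

End Mean.

(** * Bochner-Fejer approximation *)

Section Fejer.
Variable R : realType.
Notation C := R[i].
Notation nc := (@Normc.normc R).
Notation Re := complex.Re.
Notation Im := complex.Im.
Implicit Types (f g : R -> C) (s : seq (C * R)) (l x t : R) (A : seq R).

Lemma e_M l l' x : e_ l x * e_ l' x = e_ (l + l') x.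
Proof.
rewrite /e_ mulrDl cosD sinD; apply/eqP; rewrite eq_complex /=.
by apply/andP; split; apply/eqP; ring.
Qed.

Lemma e_B l x t : e_ l (x - t) = e_ l x * e_ (- l) t.
Proof.
rewrite /e_ mulrBr mulNr cosD sinD; apply/eqP; rewrite eq_complex /=.
by apply/andP; split; apply/eqP; ring.
Qed.

Lemma e_0 x : e_ 0 x = 1.
Proof. by rewrite /e_ mul0r cos0 sin0. Qed.

Lemma conjc_e l x : conjc (e_ l x) = e_ (- l) x.
Proof. by rewrite /e_ mulNr cosN sinN. Qed.

Lemma AP_P f : AP f <->
  forall e, 0 < e -> exists s, forall x, nc (f x - trig_poly s x) <= e.
Proof.
by split=> H e /H[s Hs]; exists s => x; have := Hs x; rewrite normcE lecR.
Qed.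

Lemma is_mean_trig_poly s :
  is_mean (trig_poly s) (\sum_(p <- s) p.1 * (p.2 == 0)%:R).
Proof.
by apply: (@is_mean_sum _ _ s (fun p x => p.1 * e_ p.2 x)) => p; exact/is_meanZ/is_mean_e.
Qed.

Lemma AP_ccont f : AP f -> ccont f.
Proof.
move=> /AP_P H.
have K (P : C -> R) : (forall z, `|P z| <= nc z) -> {morph P : z w / z - w} ->
    (forall s, continuous (fun x => P (trig_poly s x))) -> continuous (fun x => P (f x)).
  move=> Pn PB cP x; apply/cvgrPdist_le => e e0.
  have e3 : 0 < e / 3 by rewrite divr_gt0.
  have [s Hs] := H _ e3.
  have := cP s x => /cvgrPdist_le/(_ _ e3); apply: filterS => t h1.
  have h2 := le_trans (Pn _) (Hs x); have h3 := le_trans (Pn _) (Hs t).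
  rewrite !PB in h2 h3; move: h1 h2 h3; rewrite !ler_norml; lra.
split; apply: K.
- exact: Re_le_normc.
- by move=> z w; rewrite cReB.
- by move=> s; exact: (is_mean_trig_poly s).1.1.
- exact: Im_le_normc.
- by move=> z w; rewrite cImB.
- by move=> s; exact: (is_mean_trig_poly s).1.2.
Qed.

(** The means of the approximating polynomials are Cauchy, because means are
    controlled by suprema. *)
Lemma AP_is_mean f : AP f -> exists m, is_mean f m.
Proof.
move=> /[dup] /AP_ccont cf /AP_P H.
pose d (n : nat) : R := n.+1%:R^-1.
have d0 n : 0 < d n by rewrite invr_gt0.
have [s Hs] := choice (fun n => H _ (d0 n)).
pose M n : C := \sum_(p <- s n) p.1 * (p.2 == 0)%:R.
have Mc n k : nc (M n - M k) <= 2 * d n + 2 * d k.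
  have h := is_meanD (is_mean_trig_poly (s n)) (is_meanZ (-1) (is_mean_trig_poly (s k))).
  have Hx x : nc (trig_poly (s n) x + (-1) * trig_poly (s k) x) <= (d n + d k) * 1.
    rewrite mulN1r mulr1.
    have := normcB (f x - trig_poly (s k) x) (f x - trig_poly (s n) x).
    rewrite [X in nc X <= _ -> _](_ : _ = trig_poly (s n) x - trig_poly (s k) x); last by ring.
    have := Hs n x; have := Hs k x; lra.
  have := @is_mean_le R _ _ (fun=> 1) 1 _ h (is_mean_cst (1 : C)) Hx.
  by rewrite mulN1r [complex.Re 1]/= mulr1 mulrDr.
have [m Hm] := normc_sandwich_limit Mc.
exists m; split=> // e e0.
pose n := Num.trunc (8 / e).
have Hn : d n <= e / 8.
  by rewrite /d -[leRHS]invrK lef_pV2 ?posrE ?ltr0n// ?invr_gt0 ?divr_gt0// invf_div ltW// truncnS_gt.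
have [[ct Ht]] := is_mean_trig_poly (s n).
move=> /(_ (e / 8) ltac:(by rewrite divr_gt0))[T1 T10 H1].
exists T1 => // T hT; have T0 := lt_le_trans T10 hT.
have h1 := H1 T hT; have h2 := Hm n.
have cN := ccontM (ccont_cst (-1)) cf.
have hx x : nc (trig_poly (s n) x + (-1) * f x) <= d n.
  by rewrite mulN1r -normcN opprB; exact: Hs.
have cd : continuous (fun _ : R => d n) by move=> ?; exact: cst_continuous.
have h3 := avg_le T0 (ccontD (conj ct Ht) cN) cd hx.
rewrite avgD ?avgZ// avg_cst// mulN1r [complex.Re _]/= in h3.
rewrite -/(M n) in h1.
have -> : m - avg T f = (m - M n) + (M n - avg T (trig_poly (s n))) + (avg T (trig_poly (s n)) - avg T f) by ring.
have := le_normcD (m - M n + (M n - avg T (trig_poly (s n)))) (avg T (trig_poly (s n)) - avg T f).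
have := le_normcD (m - M n) (M n - avg T (trig_poly (s n))).
lra.
Qed.

Lemma AP_e_mul l f : AP f -> AP (fun x => e_ l x * f x).
Proof.
move=> /AP_P H; apply: (AP_P _).2 => e /H[s Hs].
exists [seq (p.1, l + p.2) | p <- s] => x.
have -> : trig_poly [seq (p.1, l + p.2) | p <- s] x = e_ l x * trig_poly s x.
  rewrite /trig_poly big_map mulr_sumr; apply: eq_bigr => p _ /=.
  by rewrite -e_M mulrCA.
by rewrite -mulrBr Normc.normcM normc_e mul1r.
Qed.

Lemma AP_fourier f l : AP f -> is_mean (fun x => e_ (- l) x * f x) (fourier_coef f l).
Proof.
move=> /(AP_e_mul (- l))/AP_is_mean[m Hm].
by rewrite /fourier_coef (is_mean_value Hm).
Qed.

(** This kernel is nonnegative and has mean 1; its Fourier coefficient at l is the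
    proportion of A that stays in A under translation by l. *)
Definition fejer_kernel A t : R :=
  (size A)%:R^-1 * nc (\sum_(a <- A) e_ a t) ^+ 2.

Lemma fejer_kernel_ge0 A t : 0 <= fejer_kernel A t.
Proof. by rewrite mulr_ge0 ?invr_ge0// sqr_ge0. Qed.

Lemma normc_sqr (z : C) : (nc z ^+ 2)%:C = z * conjc z.
Proof.
rewrite normcX2; case: z => a b; apply/eqP; rewrite eq_complex /=.
by apply/andP; split; apply/eqP; ring.
Qed.

Lemma fejer_kernelE A t : (fejer_kernel A t)%:C =
  \sum_(a <- A) \sum_(b <- A) ((size A)%:R^-1)%:C * e_ (a - b) t.
Proof.
rewrite /fejer_kernel rmorphM /= normc_sqr rmorph_sum /= big_distrlr /= mulr_sumr.
apply: eq_bigr => a _; rewrite mulr_sumr; apply: eq_bigr => b _.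
by rewrite -e_M -conjc_e.
Qed.

(** The mean over t of [g t * fejer_kernel A (x - t)], in terms of the Fourier
    coefficients [gh] of g. *)
Definition fejer A (gh : R -> C) x : C :=
  \sum_(a <- A) \sum_(b <- A) ((size A)%:R^-1)%:C * e_ (a - b) x * gh (a - b).

Lemma fejer_mean A g gh x : (forall l, is_mean (fun t => e_ (- l) t * g t) (gh l)) ->
  is_mean (fun t => g t * (fejer_kernel A (x - t))%:C) (fejer A gh x).
Proof.
move=> H; apply: (@is_mean_ext _ (fun t => \sum_(a <- A) \sum_(b <- A)
   (((size A)%:R^-1)%:C * e_ (a - b) x) * (e_ (- (a - b)) t * g t))).
  move=> t; rewrite fejer_kernelE mulr_sumr; apply: eq_bigr => a _.
  rewrite mulr_sumr; apply: eq_bigr => b _; rewrite e_B; ring.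
by apply: is_mean_sum => a; apply: is_mean_sum => b; exact: is_meanZ.
Qed.

Lemma fejer_single A l x : uniq A ->
  fejer A (fun l' => (l - l' == 0)%:R) x =
  e_ l x * ((size A)%:R^-1 * (count (fun b => b + l \in A) A)%:R)%:C.
Proof.
move=> uA; rewrite /fejer exchange_big /=.
rewrite (eq_bigr (fun b => (e_ l x * ((size A)%:R^-1)%:C) * (b + l \in A)%:R)); last first.
  move=> b _; have [bA|bA] := boolP (b + l \in A).
    rewrite (bigD1_seq (b + l)) //= big1 ?addr0.
      rewrite (_ : b + l - b = l); last by ring.
      by rewrite subrr eqxx /=; ring.
    move=> a /negbTE ab; rewrite (_ : _ == 0 = false) ?mulr0//.
    by rewrite subr_eq0 eq_sym subr_eq addrC ab.
  rewrite mulr0 big_seq big1// => a aA.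
  rewrite (_ : _ == 0 = false) ?mulr0//; apply/negP.
  rewrite subr_eq0 => /eqP e; move: bA; rewrite e addrC subrK aA//.
rewrite -mulr_sumr -mulrA; congr (_ * _); rewrite rmorphM /= rmorph_nat; congr (_ * _).
by rewrite -sum1_count [in RHS]big_mkcond natr_sum /=; apply: eq_bigr => b _; case: (_ \in _).
Qed.

Lemma fejer_kernel_mean A x : uniq A -> (0 < size A)%N ->
  is_mean (fun t => (fejer_kernel A (x - t))%:C) 1.
Proof.
move=> uA A0.
have := @fejer_mean A (fun=> 1) (fun l => (0 - l == 0)%:R) x.
rewrite fejer_single// e_0 mul1r.
have -> : count (fun b => b + 0 \in A) A = size A.
  by rewrite -[RHS]count_predT; apply: eq_in_count => b bA; rewrite addr0 bA.
rewrite mulVf ?pnatr_eq0 -?lt0n// => H.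
apply: is_mean_ext (H _) => [t|l]; first by rewrite mul1r.
by rewrite sub0r; apply: is_mean_ext (is_mean_e _) => t; rewrite mulr1.
Qed.

(** Let P be a trigonometric polynomial close to f, and A a Folner set for the
    frequencies of P.  Averaging with the kernel of A keeps [f - P] small, since
    the kernel is nonnegative with mean 1, and almost fixes P, since its
    coefficients at the frequencies of P are almost 1.  It sends f to a
    trigonometric polynomial whose coefficients are multiples of those of f. *)
Theorem AP_approx_spectrum f e : AP f -> 0 < e ->
  exists2 s, (forall p, p \in s -> fourier_coef f p.2 != 0) &
    forall x, nc (f x - trig_poly s x) <= e.
Proof.
move=> fAP e0.
have e4 : 0 < e / 4 by rewrite divr_gt0.
have [P HP] := (AP_P f).1 fAP _ e4.
pose S : R := \sum_(p <- P) nc p.1.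
have S0 : 0 <= S by apply: sumr_ge0 => p _; exact: normc_ge0.
pose d := e / 4 / (S + 1).
have d0 : 0 < d by rewrite divr_gt0// ltr_wpDl.
have [A [uA A0 HA]] := folner (map snd P) d0.
have N0 : 0 < (size A)%:R :> R by rewrite ltr0n.
pose r l : R := (size A)%:R^-1 * (count (fun b => b + l \in A) A)%:R.
have rd l : l \in map snd P -> `|1 - r l| <= d.
  move=> /HA h.
  have h1 : r l <= 1.
    by rewrite /r mulrC ler_pdivrMr// mul1r ler_nat count_size.
  have h2 : 1 - d <= r l by rewrite /r mulrC ler_pdivlMr.
  by rewrite ger0_norm; lra.
pose fh := fourier_coef f.
pose Pt x := \sum_(p <- P) p.1 * (e_ p.2 x * (r p.2)%:C).
have PtE x : fejer A (fun l => \sum_(p <- P) p.1 * (p.2 - l == 0)%:R) x = Pt x.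
  rewrite /Pt; under eq_bigr do rewrite -fejer_single// mulr_sumr.
  rewrite [RHS]exchange_big; apply: eq_bigr => a _ /=.
  under [RHS]eq_bigr do rewrite mulr_sumr.
  rewrite [RHS]exchange_big; apply: eq_bigr => b _ /=.
  rewrite mulr_sumr; apply: eq_bigr => p _; ring.
have mP x : is_mean (fun t => trig_poly P t * (fejer_kernel A (x - t))%:C) (Pt x).
  rewrite -PtE; apply: fejer_mean => l.
  apply: (@is_mean_ext _ (fun t => \sum_(p <- P) p.1 * e_ (p.2 - l) t)).
    move=> t; rewrite /trig_poly mulr_sumr; apply: eq_bigr => p _.
    by rewrite -e_M [e_ p.2 t * _]mulrC mulrCA.
  by apply: is_mean_sum => p; exact/is_meanZ/is_mean_e.
have mf x : is_mean (fun t => f t * (fejer_kernel A (x - t))%:C) (fejer A fh x).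
  by apply: fejer_mean => l; exact: AP_fourier.
have close x : nc (fejer A fh x - Pt x) <= e / 2.
  have h := is_meanD (mf x) (is_meanZ (-1) (mP x)).
  have Hx t : nc (f t * (fejer_kernel A (x - t))%:C + (-1) * (trig_poly P t * (fejer_kernel A (x - t))%:C))
      <= e / 4 * fejer_kernel A (x - t).
    rewrite mulN1r -mulrBl Normc.normcM normc_real ger0_norm ?fejer_kernel_ge0//.
    by rewrite ler_wpM2r ?fejer_kernel_ge0.
  have := is_mean_le h (fejer_kernel_mean x uA A0) Hx.
  rewrite mulN1r [complex.Re 1]/=; lra.
have PPt x : nc (trig_poly P x - Pt x) <= e / 4.
  rewrite /trig_poly /Pt -sumrB.
  have sumle (Q : seq (C * R)) : {subset Q <= P} ->
     nc (\sum_(p <- Q) (p.1 * e_ p.2 x - p.1 * (e_ p.2 x * (r p.2)%:C))) <= d * \sum_(p <- Q) nc p.1.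
    elim: Q => [|p Q IH] QP; first by rewrite !big_nil mulr0 Normc.normc0.
    rewrite !big_cons mulrDr; apply: le_trans (le_normcD _ _) _; apply: lerD; last first.
      by apply: IH => q qQ; apply: QP; rewrite inE qQ orbT.
    have -> : p.1 * e_ p.2 x - p.1 * (e_ p.2 x * (r p.2)%:C) = p.1 * e_ p.2 x * (1 - r p.2)%:C.
      by rewrite rmorphB /= rmorph1; ring.
    rewrite !Normc.normcM normc_e mulr1 normc_real mulrC ler_wpM2r ?normc_ge0//.
    by apply: rd; apply: map_f; apply: QP; rewrite inE eqxx.
  apply: le_trans (sumle P _) _ => //; rewrite -/S.
  have : d * (S + 1) = e / 4 by rewrite /d; field; lra.
  lra.
pose s0 := [seq ((((size A)%:R^-1)%:C * fh (a - b)), a - b) | a <- A, b <- A].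
have s0E x : trig_poly s0 x = fejer A fh x.
  rewrite /trig_poly /s0 big_allpairs_dep; apply: eq_bigr => a _; apply: eq_bigr => b _ /=.
  ring.
exists [seq p <- s0 | fh p.2 != 0]; first by move=> p; rewrite mem_filter => /andP[].
move=> x.
have -> : trig_poly [seq p <- s0 | fh p.2 != 0] x = fejer A fh x.
  rewrite -s0E /trig_poly big_filter big_mkcond /= !big_seq; apply: eq_bigr => p.
  move=> /allpairsP[[a b] /= [_ _ ->]] /=; case: ifPn => // /negPn/eqP ->.
  by rewrite mulr0 mul0r.
have -> : f x - fejer A fh x = (f x - trig_poly P x) + (trig_poly P x - Pt x) - (fejer A fh x - Pt x) by ring.
apply: le_trans (normcB _ _) _.
have := le_normcD (f x - trig_poly P x) (trig_poly P x - Pt x).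
have := HP x; have := PPt x; have := close x; lra.
Qed.

End Fejer.

(** * The Hardy classes *)

Section HardyClass.
Variable R : realType.
Notation mu := (@lebesgue_measure R).
Notation C := R[i].
Notation nc := (@Normc.normc R).
Notation Re := complex.Re.
Notation Im := complex.Im.
Notation cderivable F z := (derivable ((F : C -> C) : C^o -> C^o) z 1).
Implicit Types (f g : R -> C) (F G : C -> C) (U : set C) (l x : R).

Lemma Hinf_ae U f g : {ae mu, forall x, f x = g x} -> Hinf U f -> Hinf U g.
Proof.
move=> fg [F [aF bF lF]]; exists F; split; [exact: aF|exact: bF|].
by apply: ae_imp2 fg lF => x ->.
Qed.

Lemma Hinf_cst U (c : C) : Hinf U (fun=> c).
Proof.
exists (fun=> c); split.
- by move=> z _; exact: cderivable_cst.
- by apply: (bounded_fun_onP _ _).2; exists (nc c).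
- by apply: aeW => x a a0; exact: cvg_cst.
Qed.

Lemma HinfD U f g : Hinf U f -> Hinf U g -> Hinf U (fun x => f x + g x).
Proof.
move=> [F [aF bF lF]] [G [aG bG lG]]; exists (fun z => F z + G z); split.
- by move=> z Uz; exact: (cderivableD (aF z Uz) (aG z Uz)).
- move: bF bG => /bounded_fun_onP[M1 H1] /bounded_fun_onP[M2 H2].
  apply: (bounded_fun_onP _ _).2; exists (M1 + M2) => z Uz.
  by apply: le_trans (le_normcD _ _) _; apply: lerD; [exact: H1|exact: H2].
- apply: ae_imp2 lF lG => x HF HG a a0.
  exact: (cvgD (HF a a0) (HG a a0)).
Qed.

Lemma HinfM U f g : Hinf U f -> Hinf U g -> Hinf U (fun x => f x * g x).
Proof.
move=> [F [aF bF lF]] [G [aG bG lG]]; exists (fun z => F z * G z); split.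
- by move=> z Uz; exact: (cderivableM (aF z Uz) (aG z Uz)).
- move: bF bG => /bounded_fun_onP[M1 H1] /bounded_fun_onP[M2 H2].
  apply: (bounded_fun_onP _ _).2; exists (M1 * M2) => z Uz.
  by rewrite Normc.normcM; apply: ler_pM; rewrite ?normc_ge0//; [exact: H1|exact: H2].
- apply: ae_imp2 lF lG => x HF HG a a0.
  exact: (@cvgM C _ _ _ _ _ _ _ (HF a a0) (HG a a0)).
Qed.

Lemma Hinf_sum U (I : Type) (r : seq I) (P : pred I) (f : I -> R -> C) :
  (forall i, P i -> Hinf U (f i)) -> Hinf U (fun x => \sum_(i <- r | P i) f i x).
Proof.
move=> H; elim: r => [|i r IH].
  by rewrite (_ : (fun _ => _) = fun=> 0); [exact: Hinf_cst|apply/funext => x; rewrite big_nil].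
have [Pi|nPi] := boolP (P i).
  rewrite (_ : (fun _ => _) = fun x => f i x + \sum_(i <- r | P i) f i x).
    exact: HinfD (H i Pi) IH.
  by apply/funext => x; rewrite big_cons Pi.
rewrite (_ : (fun _ => _) = fun x => \sum_(i <- r | P i) f i x)//.
by apply/funext => x; rewrite big_cons (negbTE nPi).
Qed.

(** The reflection [z -> conj (F (conj z))] exchanges the half-planes and leaves the
    real line fixed pointwise. *)
Lemma Hinf_conj U V f : (forall z, V z -> U (conjc z)) -> Hinf U f ->
  Hinf V (fun x => conjc (f x)).
Proof.
move=> VU [F [aF /bounded_fun_onP[M bF] lF]].
exists (fun z => conjc (F (conjc z))); split.
- by move=> z /VU Uz; exact: cderivable_conj (aF _ Uz).
- by apply: (bounded_fun_onP _ _).2; exists M => z /VU Uz; rewrite normc_conj; exact: bF.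
- apply: ae_imp lF => x /nontangential_limitP H.
  apply: (nontangential_limitP _ _ _ _).2 => a a0 e e0.
  have [d d0 Hd] := H a a0 e e0; exists d => // z /VU Uz az zd.
  rewrite -rmorphB normc_conj; apply: Hd => //.
    by case: z az {Uz zd} => p q /=; rewrite normrN.
  by rewrite -(conjc_real x) -rmorphB normc_conj.
Qed.

Lemma Hinf_plus_conj f : Hinf_plus f -> Hinf_minus (fun x => conjc (f x)).
Proof.
apply: Hinf_conj => -[a b]; rewrite /lower_half /upper_half /=.
by rewrite oppr_gt0.
Qed.

Lemma AP_plus_Hinf f : AP_plus f -> Hinf_plus f.
Proof.
move=> [fAP Of]; apply: nonneg_approx_Hinf_plus => e e0.
have [s sO Hs] := AP_approx_spectrum fAP e0.
by exists s => // p /sO; exact: Of.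
Qed.

(** Conjugation changes the sign of the frequencies. *)
Lemma AP_minus_Hinf f : AP_minus f -> Hinf_minus f.
Proof.
move=> [fAP Of].
suff /Hinf_plus_conj : Hinf_plus (fun x => conjc (f x)).
  by rewrite (_ : (fun x => _) = f)//; apply/funext => x; rewrite conjcK.
apply: nonneg_approx_Hinf_plus => e e0.
have [s sO Hs] := AP_approx_spectrum fAP e0.
exists [seq (conjc p.1, - p.2) | p <- s].
  by move=> _ /mapP[p /sO/Of ps ->] /=; rewrite oppr_ge0.
move=> x; have -> : trig_poly [seq (conjc p.1, - p.2) | p <- s] x = conjc (trig_poly s x).
  rewrite /trig_poly big_map rmorph_sum; apply: eq_bigr => p _ /=.
  by rewrite -conjc_e rmorphM.
by rewrite -rmorphB normc_conj.
Qed.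

Lemma nontangential_limit_cst F x w c : (forall z, 0 < Im z -> F z = c) ->
  nontangential_limit (@upper_half R) F x w -> w = c.
Proof.
move=> Fc /nontangential_limitP/(_ 1 ltr01) H.
apply/eqP; rewrite -subr_eq0; apply/eqP/Normc.eq0_normc/eqP.
rewrite eq_le normc_ge0 andbT; apply/ler_addgt0Pr => e e0; rewrite add0r.
have [d d0 Hd] := H e e0.
have z0 : 0 < d / 2 by rewrite divr_gt0.
rewrite -(Fc (x +i* (d / 2)))//; apply: Hd => //=.
  by rewrite subrr normr0 mul1r.
by rewrite subrr oppr0 addr0 expr0n add0r sqrtr_sqr gtr0_norm//; lra.
Qed.

Lemma nontangential_limit_continuous U F x : cderivable F (x +i* 0) ->
  nontangential_limit U F x (F (x +i* 0)).
Proof.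
move=> dF; apply: (nontangential_limitP _ _ _ _).2 => a a0 e e0.
have [d d0 Hd] := cderivable_normc_continuous dF e0.
exists d => // z _ _ zd.
have E : (x +i* 0) + (z - x%:C) = z by rewrite addrC; exact: subrK.
by have := Hd _ zd; rewrite E -normcN opprB.
Qed.

Lemma Hinf_plus_minus_cst f : Hinf_plus f -> Hinf_minus f ->
  exists c, {ae mu, forall x, f x = c}.
Proof.
move=> [F [aF bF lF]] [G [aG bG lG]].
have [c Fc] := hardy_liouville aF aG bF bG lF lG.
by exists c; apply: ae_imp lF => x; exact: nontangential_limit_cst.
Qed.

(** If F extends f, then [F(z) exp (i l z)] is a constant c by [hardy_liouville], and
    [c exp (- i l z)] is bounded on the imaginary axis only for [c = 0]. *)
Lemma Hinf_plus_shift_minus f l : 0 < l -> Hinf_plus f ->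
  Hinf_minus (fun x => e_ l x * f x) -> {ae mu, forall x, f x = 0}.
Proof.
move=> l0 [F [aF bF lF]] [G [aG bG lG]].
have [M bM] := (bounded_fun_onP _ _).1 bF.
pose E z := cexp l z * F z.
have Ele z : 0 < Im z -> nc (cexp l z) <= 1.
  by move=> z0; rewrite normc_cexp -expR0 ler_expR oppr_le0 mulr_ge0// ltW.
have aE : analytic_on (@upper_half R) E.
  by move=> z Uz; exact: (cderivableM (@cexp_cderivable R l z) (aF z Uz)).
have bE : bounded_fun_on (@upper_half R) E.
  apply: (bounded_fun_onP _ _).2; exists M => z Uz.
  by rewrite Normc.normcM -[leRHS]mul1r ler_pM ?normc_ge0//; [exact: Ele|exact: bM].
have lE : {ae mu, forall x, nontangential_limit (@upper_half R) E x (e_ l x * f x)}.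
  apply: ae_imp lF => x HF a a0.
  have := @nontangential_limit_continuous (@upper_half R) _ x (@cexp_cderivable R l (x +i* 0)).
  rewrite cexp_real => /(_ a a0) HE.
  exact: (@cvgM C _ _ _ _ _ _ _ HE (HF a a0)).
have [c Ec] := hardy_liouville aE aG bE bG lE lG.
have c0 : c = 0.
  apply: Normc.eq0_normc; apply/eqP; rewrite eq_le normc_ge0 andbT leNgt.
  apply/negP => nc0.
  have M0 : 0 <= M.
    by apply: le_trans (bM (0 +i* 1) _); [exact: normc_ge0|exact: ltr01].
  (* Since [1 + l y <= exp (l y)], this height makes [|c| exp (l y)] exceed M. *)
  pose y := (M + 1) / (nc c * l).
  have y0 : 0 < y by rewrite divr_gt0 ?mulr_gt0//; lra.
  have := Ec (0 +i* y) y0; have := bM (0 +i* y) y0; rewrite /E.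
  move=> h e; have := congr1 nc e; rewrite Normc.normcM normc_cexp [complex.Im _]/= => h2.
  have h3 : nc c * expR (l * y) <= M.
    by rewrite -h2 mulrAC -expRD addNr expR0 mul1r.
  have h4 : nc c * (1 + l * y) <= nc c * expR (l * y).
    by rewrite ler_wpM2l ?normc_ge0//; exact: expR_ge1Dx.
  have h5 : nc c * (1 + l * y) = nc c + (M + 1) by rewrite /y; field; lra.
  lra.
have F0 z : 0 < Im z -> F z = 0.
  move=> z0; apply/eqP; have := Ec z z0; rewrite c0 => /eqP; rewrite mulf_eq0 => /orP[|//].
  move=> /eqP e; have := normc_cexp l z; rewrite e Normc.normc0 => h.
  by have := expR_gt0 (- (l * Im z)); rewrite -h ltxx.
by apply: ae_imp lF => x; exact: nontangential_limit_cst.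
Qed.

End HardyClass.

(** * The general solution *)

Lemma ae_forall_ord (R : realType) (n : nat) (P : 'I_n -> R -> Prop) :
  (forall j, {ae (@lebesgue_measure R), forall x, P j x}) ->
  {ae (@lebesgue_measure R), forall x, forall j, P j x}.
Proof. exact: (@filter_forall _ _ _ _ (ae_filter_ringOfSetsType _)). Qed.

Lemma mulmx_cols (K : comNzRingType) (n : nat) (A : 'M[K]_n) (v : 'I_n -> K) (P : pred 'I_n) :
  \sum_(j < n | P j) v j *: col j A = A *m (\col_j (if P j then v j else 0)).
Proof.
apply/matrixP => i k; rewrite !mxE summxE big_mkcond; apply: eq_bigr => j _.
by rewrite !mxE; case: (P j); rewrite ?mulr0// mulrC.
Qed.

Theorem theorem3p3 (R : realType) (n : nat) (G Gm Gp : R -> 'M[R[i]]_n)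
    (delta : 'I_n -> R) (hG : AP_factorization G Gm Gp delta)
    (phip phim : R -> 'cV[R[i]]_n) :
  is_solution G phip phim <->
  exists psi : 'I_n -> R -> R[i],
    [/\ forall j, delta j <= 0 -> admissible_coef (delta j) (psi j),
        {ae (@lebesgue_measure R), forall x, phip x =
           \sum_(j < n | delta j <= 0) psi j x *: col j (Gp x)} &
        {ae (@lebesgue_measure R), forall x, phim x =
           \sum_(j < n | delta j <= 0)
              (e_ (delta j) x * psi j x) *: col j (Gm x)}].
Proof.
case: hG => -[uGp aGp aGp'] [uGm aGm aGm'] GE.
have hGp i j := AP_plus_Hinf (aGp i j).
have hGp' i j := AP_plus_Hinf (aGp' i j).
have hGm i j := AP_minus_Hinf (aGm i j).
have hGm' i j := AP_minus_Hinf (aGm' i j).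
split.
- move=> [hp hm hs].
  (* The unknowns of the diagonal problem. *)
  pose psi j x := (invmx (Gp x) *m phip x) j 0.
  pose chi j x := (invmx (Gm x) *m phim x) j 0.
  have psiH j : Hinf_plus (psi j).
    rewrite (_ : psi j = fun x => \sum_k invmx (Gp x) j k * phip x k 0).
      by apply: Hinf_sum => k _; exact: HinfM (hGp' j k) (hp k).
    by apply/funext => x; rewrite /psi mxE.
  have chiH j : Hinf_minus (chi j).
    rewrite (_ : chi j = fun x => \sum_k invmx (Gm x) j k * phim x k 0).
      by apply: Hinf_sum => k _; exact: HinfM (hGm' j k) (hm k).
    by apply/funext => x; rewrite /chi mxE.
  have link : {ae (@lebesgue_measure R), forall x, forall j, e_ (delta j) x * psi j x = chi j x}.
    apply: ae_imp hs => x E j; rewrite /chi -E GE -!mulmxA mulKmx// mul_diag_mx mxE mxE.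
    by [].
  have linkj j : {ae (@lebesgue_measure R), forall x, chi j x = e_ (delta j) x * psi j x}.
    by apply: ae_imp link => x ->.
  have psi0 j : 0 < delta j -> {ae (@lebesgue_measure R), forall x, psi j x = 0}.
    by move=> dj; exact: Hinf_plus_shift_minus dj (psiH j) (Hinf_ae (linkj j) (chiH j)).
  have zero : {ae (@lebesgue_measure R), forall x, forall j, 0 < delta j -> psi j x = 0}.
    apply: ae_forall_ord => j; have [dj|dj] := boolP (0 < delta j).
      by apply: ae_imp (psi0 j dj) => x.
    by apply: aeW => x.
  have colE x : (forall j, 0 < delta j -> psi j x = 0) -> forall v : 'I_n -> R[i],
      (\col_j (if delta j <= 0 then v j * psi j x else 0)) = \col_j (v j * psi j x).
    move=> z v; apply/matrixP => j k; rewrite !mxE; case: leP => // /z ->.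
    by rewrite mulr0.
  exists psi; split.
  + move=> j _; split=> dj.
      apply: (Hinf_plus_minus_cst (psiH j)); apply: Hinf_ae (chiH j).
      by apply: ae_imp (linkj j) => x ->; rewrite dj e_0 mul1r.
    split; first exact: psiH.
    exists (chi j); first exact: chiH.
    apply: ae_imp (linkj j) => x ->.
    by rewrite mulrA e_M addNr e_0 mul1r.
  + apply: ae_imp zero => x z.
    rewrite mulmx_cols (_ : \col_j _ = invmx (Gp x) *m phip x); first by rewrite mulKVmx.
    have := colE x z (fun=> 1).
    rewrite (_ : \col_j (if _ then _ else _) = \col_j (if delta j <= 0 then psi j x else 0)).
      by move=> ->; apply/matrixP => j k; rewrite !mxE mul1r ord1 /psi mxE.
    by apply/matrixP => j k; rewrite !mxE mul1r.
  + apply: ae_imp2 zero link => x z l.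
    rewrite mulmx_cols colE// (_ : \col_j _ = invmx (Gm x) *m phim x); first by rewrite mulKVmx.
    by apply/matrixP => j k; rewrite !mxE l ord1 /chi mxE.
- move=> [psi [adm pp pm]].
  have psiH j : delta j <= 0 -> Hinf_plus (psi j).
    move=> dj; have [ac al] := adm j dj.
    have [/al[]//|d0] := ltP (delta j) 0.
    have [c Hc] := ac (le_anti (introT andP (conj dj d0))).
    by apply: Hinf_ae (Hinf_cst _ c); apply: ae_imp Hc => x ->.
  have chiH j : delta j <= 0 -> Hinf_minus (fun x => e_ (delta j) x * psi j x).
    move=> dj; have [ac al] := adm j dj.
    have [/al[_ [h hh Hh]]|d0] := ltP (delta j) 0.
      apply: Hinf_ae hh; apply: ae_imp Hh => x ->.
      by rewrite mulrA e_M subrr e_0 mul1r.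
    have dj0 : delta j = 0 := le_anti (introT andP (conj dj d0)).
    have [c Hc] := ac dj0.
    by apply: Hinf_ae (Hinf_cst _ c); apply: ae_imp Hc => x ->; rewrite dj0 e_0 mul1r.
  split.
  + move=> i; have := @Hinf_sum R (@upper_half R) _ (index_enum 'I_n) (fun j => delta j <= 0)
      (fun j x => psi j x * Gp x i j) (fun j dj => HinfM (psiH j dj) (hGp i j)).
    apply: Hinf_ae; apply: ae_imp pp => x ->.
    by rewrite summxE; apply: eq_bigr => j _; rewrite !mxE.
  + move=> i; have := @Hinf_sum R (@lower_half R) _ (index_enum 'I_n) (fun j => delta j <= 0)
      (fun j x => e_ (delta j) x * psi j x * Gm x i j) (fun j dj => HinfM (chiH j dj) (hGm i j)).
    apply: Hinf_ae; apply: ae_imp pm => x ->.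
    by rewrite summxE; apply: eq_bigr => j _; rewrite !mxE.
  + apply: ae_imp2 pp pm => x -> ->.
    rewrite !mulmx_cols GE -!mulmxA mulKmx//; congr (_ *m _).
    rewrite mul_diag_mx; apply/matrixP => j k; rewrite !mxE.
    by case: ifP => // _; rewrite mulr0.
Qed.
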